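(* Let $\mathbb{K}$ be an algebraically closed field of characteristic zero and let $G$ be a connected commutative linear algebraic group over $\mathbb{K}$ of dimension $n\ge 1$ and rank $r\ge 1$. Then there exist, up to equivalence, precisely $p_r(n)$ prehomogeneous $G$-modules with a finite number of $G$-orbits. The corresponding algebras $A$ are precisely the algebras of the form $\mathbb{K}[x]/(f(x))$, where $f(x)\in\mathbb{K}[x]$ is a polynomial of degree $n$ with exactly $r$ distinct roots.
   Context: For positive integers $n$ and $r$, $p_r(n)$ denotes the number of partitions $n=n_1+\ldots+n_r$ with integers $n_1\ge\ldots\ge n_r\ge 1$. Every connected commutative linear algebraic group over $\mathbb{K}$ is isomorphic to $(\mathbb{G}_m)^r\times(\mathbb{G}_a)^s$ for unique $r,s\ge 0$; $r$ is its rank. A prehomogeneous $G$-module is a finite dimensional $\mathbb{K}$-vector space $V$ with an effective linear algebraic action of $G$, so that $G$ is identified with a closed subgroup of $\mathrm{GL}(V)$, such that $G$ has an open orbit in $V$. Two prehomogeneous modules $V,V'$ are equivalent if there is an isomorphism of vector spaces $V\to V'$ whose induced isomorphism $\mathrm{GL}(V)\to\mathrm{GL}(V')$ maps the image of the group acting on $V$ onto the image of the group acting on $V'$. For a finite dimensional commutative associative unital $\mathbb{K}$-algebra $A$, its group $G(A)$ of invertible elements acts on $A$ by multiplication, making $A$ a prehomogeneous $G(A)$-module. Every prehomogeneous $G$-module $V$ of a commutative linear algebraic group is equivalent to the $G(A)$-module $A$ for such an algebra $A$, unique up to isomorphism; $A$ is called the algebra corresponding to $V$. *)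

(* Defs.v *)
From mathcomp Require Import all_boot all_order all_algebra all_field.
From mathcomp Require Import mpoly.

Set Implicit Arguments.
Unset Strict Implicit.
Unset Printing Implicit Defensive.

Import GRing.Theory.
Local Open Scope ring_scope.

Definition partitions_count (r n : nat) : nat :=
  #|[set t : r.-tuple 'I_n.+1 |
       [&& sorted geq [seq val i | i <- t],
           all (fun i : 'I_n.+1 => 0 < i)%N t
         & \sum_(i <- t) i == n]%N]|.

Section Zariski.
Variables (K : fieldType) (V : vectType K).

Definition coords (v : V) (i : 'I_(\dim {:V})) : K := coord (vbasis {:V}) i v.

Definition zariski_closed (S : V -> Prop) : Prop :=
  exists I : {mpoly K[\dim {:V}]} -> Prop,
    forall v, S v <-> (forall p, I p -> p.@[coords v] = 0).

Definition zariski_open (S : V -> Prop) : Prop :=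
  zariski_closed (fun v => ~ S v).

(* Connectedness of S for the topology induced by the Zariski topology of V. *)
Definition zariski_connected (S : V -> Prop) : Prop :=
  (exists v, S v) /\
  forall Z1 Z2 : V -> Prop, zariski_closed Z1 -> zariski_closed Z2 ->
    (forall v, S v -> Z1 v \/ Z2 v) ->
    (forall v, S v -> ~ (Z1 v /\ Z2 v)) ->
    (forall v, S v -> Z1 v) \/ (forall v, S v -> Z2 v).

End Zariski.

Section AlgebraicGroups.
Variable K : fieldType.

(* Linear algebraic groups are taken to be Zariski closed subgroups of GL_m. *)
Record linear_algebraic_group m (G : 'M[K]_m -> Prop) : Prop := {
  lag_unit : forall g, G g -> g \in unitmx;
  lag_one : G 1%:M;
  lag_mul : forall g h, G g -> G h -> G (g *m h);
  lag_inv : forall g, G g -> G (invmx g);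
  lag_closed : exists2 Z : 'M[K]_m -> Prop, zariski_closed Z &
    forall g, G g <-> g \in unitmx /\ Z g
}.

Definition commutative_group m (G : 'M[K]_m -> Prop) : Prop :=
  forall g h, G g -> G h -> g *m h = h *m g.

(* The coordinate ring of GL_m is K[x_ij, 1/det], and that of a closed subgroup
   is a quotient of it. *)
Definition regular_on m (G : 'M[K]_m -> Prop) (f : 'M[K]_m -> K) : Prop :=
  exists (p : {mpoly K[\dim {: 'M[K]_m}]}) (k : nat),
    forall g, G g -> f g = p.@[coords g] / \det g ^+ k.

Definition group_morphism m l (G : 'M[K]_m -> Prop) (H : 'M[K]_l -> Prop)
    (phi : 'M[K]_m -> 'M[K]_l) : Prop :=
  [/\ forall g, G g -> H (phi g),
      forall g h, G g -> G h -> phi (g *m h) = phi g *m phi h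
    & forall i j, regular_on G (fun g => phi g i j)].

Definition group_isomorphic m l (G : 'M[K]_m -> Prop) (H : 'M[K]_l -> Prop)
    : Prop :=
  exists (phi : 'M[K]_m -> 'M[K]_l) (psi : 'M[K]_l -> 'M[K]_m),
    [/\ group_morphism G H phi, group_morphism H G psi,
        forall g, G g -> psi (phi g) = g
      & forall h, H h -> phi (psi h) = h].

(* (G_m)^r x (G_a)^s, with t in (G_m)^r embedded as diag(t) and a in (G_a)^s
   as the unipotent matrix with rows (1 a) and (0 I). *)
Definition torus_vector_group (r s : nat) (M : 'M[K]_(r + (1 + s))) : Prop :=
  exists (t : 'rV[K]_r) (a : 'rV[K]_s),
    (forall i, t 0 i != 0) /\
    M = block_mx (diag_mx t) 0 0 (block_mx 1%:M a 0 1%:M).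

Definition has_rank m (G : 'M[K]_m -> Prop) (r : nat) : Prop :=
  exists s : nat, group_isomorphic G (@torus_vector_group r s).

Definition algebraically_independent m (G : 'M[K]_m -> Prop) (d : nat)
    (f : 'I_d -> 'M[K]_m -> K) : Prop :=
  forall p : {mpoly K[d]},
    (forall g, G g -> p.@[fun i => f i g] = 0) -> p = 0.

(* The dimension of an irreducible affine variety, as the transcendence degree
   of its function field.  A connected algebraic group is irreducible, so K[G]
   is a domain and this degree is computed by families in K[G]. *)
Definition has_dimension m (G : 'M[K]_m -> Prop) (n : nat) : Prop :=
  (exists2 f : 'I_n -> 'M[K]_m -> K,
     forall i, regular_on G (f i) & algebraically_independent G f) /\
  (forall d (f : 'I_d -> 'M[K]_m -> K),
     (forall i, regular_on G (f i)) -> algebraically_independent G f ->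
     (d <= n)%N).

End AlgebraicGroups.

Section Modules.
Variable K : fieldType.

(* The values of [action] outside G are irrelevant. *)
Record prehomogeneous_module m (G : 'M[K]_m -> Prop) := PrehomogeneousModule {
  space : vectType K;
  action : 'M[K]_m -> 'End(space);
  action_one : action 1%:M = \1%VF;
  action_mul : forall g h, G g -> G h ->
    action (g *m h) = (action g \o action h)%VF;
  action_regular : forall (l : 'Hom(space, K^o)) (v : space),
    regular_on G (fun g => l (action g v));
  action_effective : forall g, G g -> action g = \1%VF -> g = 1%:M;
  action_open_orbit : exists v : space,
    zariski_open (fun w => exists2 g, G g & w = action g v)
}.

Definition finitely_many_orbits m (G : 'M[K]_m -> Prop)
    (M : prehomogeneous_module G) : Prop :=
  exists s : seq (space M), forall v : space M,
    exists2 w, w \in s & exists2 g, G g & v = action M g w.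

Definition module_image m (G : 'M[K]_m -> Prop) (M : prehomogeneous_module G)
    (h : 'End(space M)) : Prop :=
  exists2 g, G g & h = action M g.

Definition algebra_image (A : falgType K) (h : 'End(A)) : Prop :=
  exists2 a : A, a \is a GRing.unit & h = amull a.

(* H and H' are the images in GL(V) and GL(V') of the groups acting. *)
Definition equivalent_images (V V' : vectType K)
    (H : 'End(V) -> Prop) (H' : 'End(V') -> Prop) : Prop :=
  exists2 L : 'Hom(V, V'), bijective L &
    forall h', H' h' <-> exists2 h, H h & h' = (L \o h \o L^-1)%VF.

Definition equivalent_modules m (G : 'M[K]_m -> Prop)
    (M M' : prehomogeneous_module G) : Prop :=
  equivalent_images (@module_image m G M) (@module_image m G M').

Definition corresponding_algebra m (G : 'M[K]_m -> Prop)
    (M : prehomogeneous_module G) (A : falgType K) : Prop :=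
  (forall x y : A, x * y = y * x) /\
  equivalent_images (@module_image m G M) (@algebra_image A).

Definition has_distinct_roots (f : {poly K}) (r : nat) : Prop :=
  exists s : seq K, [/\ uniq s, size s = r & forall x, root f x = (x \in s)].

(* [{poly %/ h}] is K[x]/(h) only for h monic and non-constant, so f is
   replaced by its monic associate; this is K[x]/(f) for f non-constant. *)
Definition isomorphic_to_quotient (A : falgType K) (f : {poly K}) : Prop :=
  exists phi : {lrmorphism A -> {poly %/ ((lead_coef f)^-1 *: f)}},
    bijective phi.

End Modules.

(* Main.v *)
From HB Require Import structures.
Require Import Defs.
From mathcomp Require Import all_boot all_order all_algebra all_field.
From mathcomp Require Import mpoly.
From mathcomp Require Import perm ring.
From Stdlib Require Import Classical ClassicalEpsilon.

(** A module with an open orbit G.v is the regular module of a commutative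
    algebra A on which G acts as the whole unit group: evaluation at v
    identifies the span of G in End(V) with V, and for a unit a of A the sets G
    and a.G are both nonempty and open in A, so they meet.

    If the unit group of A has finitely many orbits, then A has finitely many
    principal ideals, and since a vector space over an infinite field is not a
    finite union of proper subspaces, the nilradical is a principal ideal xA.
    With e_1, ..., e_rho the primitive idempotents, A = sum K e_i + xA, and
    y = sum lam_i e_i + x generates A whenever the lam_i are distinct: A is
    K[X] modulo the product of the (X - lam_i)^(m_i), where m_i is the length of
    the local factor e_i A.  Conversely the orbits in such an algebra are those
    of the elements sum x^(k_i) e_i.

    The unit group of A is (K^x)^rho times exp(xA).  The injection of
    (G_m)^r x (G_a)^s into it gives r <= rho by counting elements of order two,
    and s <= dim xA since the logarithm is linear on (G_a)^s; on the other hand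
    rho + dim xA = dim A <= dim G = r + s, as the orbit map of v has dense
    image.  Hence rho = r and dim A = n.

    Finally, if phi : K[X]/(f) -> K[X]/(g) is an isomorphism, phi(X) = h and g
    is the product of the (X - b_j)^(m_j), then f divides, and therefore equals,
    the product of the (X - h(b_j))^(m_j): the multiplicities are invariants. *)

(** A morphism of additive groups is a priori only linear over the rationals. Linearity of the
    logarithm comes from regularity: along a line in (G_a)^s the matrix entries are polynomials in
    the parameter, and polynomials that agree at all natural numbers are equal in characteristic
    zero. Nowhere vanishing polynomials being constant, the residues are 1 along such lines.

    The dimension of G is a transcendence degree, so dim G = r + s is itself proved on the
    parametrization by (G_m)^r x (G_a)^s: the coordinates are independent, and n > r + s functions
    are dependent because B^n monomials in them land, after clearing denominators, in a space whose
    dimension grows only like B^(r+s).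

    Equivalence of modules compares only the sets of multiplications by units. It determines the
    algebra because every element is a sum of two units. The scalars lam_i are arbitrary distinct
    elements, so the isomorphism class depends on the multiplicities alone. *)

Set Implicit Arguments.
Unset Strict Implicit.
Unset Printing Implicit Defensive.
Import GRing.Theory.
Local Open Scope ring_scope.

(** * Commutative algebras with finitely many unit orbits *)

(* An alias carrying the commutativity of A as a canonical structure. *)
Definition comalg (K : fieldType) (A : falgType K)
  (mulC : commutative (@GRing.mul A)) : Type := A.

HB.instance Definition _ (K : fieldType) (A : falgType K)
  (mulC : commutative (@GRing.mul A)) := Falgebra.copy (comalg mulC) A.
HB.instance Definition _ (K : fieldType) (A : falgType K)
    (mulC : commutative (@GRing.mul A)) :=
  GRing.PzRing_hasCommutativeMul.Build (comalg mulC) mulC.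

Section InfiniteField.
Variables (K : fieldType) (charK0 : [pchar K]%R =i pred0).

Lemma natr_inj_pchar0 : injective (fun n : nat => n%:R : K).
Proof.
move=> i j /eqP /=; wlog ltij : i j / (i <= j)%N.
  by move=> W; case/orP: (leq_total i j) => [/W // | /W H] /eqP/esym/eqP/H.
rewrite eq_sym -subr_eq0 -natrB // ((pcharf0P K).1 charK0) subn_eq0 => leji.
by apply/eqP; rewrite eqn_leq ltij leji.
Qed.

Lemma exists_notin (s : seq K) : exists c, c \notin s.
Proof.
pose t := [seq (i%:R : K) | i <- iota 0 (size s).+1].
have Ut : uniq t by rewrite map_inj_uniq ?iota_uniq //; apply: natr_inj_pchar0.
case: (boolP (all (mem s) t)) => [/allP sub|/allPn [c _ cs]]; last by exists c.
by have := uniq_leq_size Ut sub; rewrite size_map size_iota ltnn.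
Qed.

Lemma poly_nat_eq (p q : {poly K}) :
  (forall n : nat, p.[n%:R] = q.[n%:R]) -> p = q.
Proof.
move=> H; apply/eqP; rewrite -subr_eq0; apply/eqP.
pose d := p - q; pose t := [seq (i%:R : K) | i <- iota 0 (size d)].
apply: (@roots_geq_poly_eq0 _ _ t).
- by apply/allP => c /mapP [i _ ->]; rewrite /root !hornerE H subrr.
- by rewrite map_inj_uniq ?iota_uniq //; apply: natr_inj_pchar0.
- by rewrite size_map size_iota.
Qed.

(** [P] is a linear subspace given as a predicate, the form in which the nilpotents appear. If [v]
    avoids the members of [s] and [u] avoids [W], the line through [v] directed by [u] meets each
    member of [s] at most once, and meets [W] only at [v] when [v] lies in it; an infinite field
    leaves a good parameter. *)
Lemma subspace_avoidance (V : vectType K) (P : V -> Prop) (s : seq {vspace V}) :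
  P 0 -> (forall c u v, P u -> P v -> P (u + c *: v)) ->
  (forall W, W \in s -> exists2 u, P u & u \notin W) ->
  exists2 v, P v & forall W, W \in s -> v \notin W.
Proof.
move=> P0 PD; elim: s => [|W s IH] Hs; first by exists 0.
case: IH => [W' sW'|v Pv vs]; first by apply: Hs; rewrite inE sW' orbT.
case: (Hs W); first exact: mem_head.
move=> u Pu uW; case: (boolP (v \in W)) => [vW|vW]; last first.
  by exists v => // W'; rewrite inE => /predU1P [->|/vs].
have [B HB] : exists B : seq K,
    forall c, c \notin B -> forall W', W' \in s -> v + c *: u \notin W'.
  elim: s vs {Hs} => [|W1 s IHs] vs; first by exists [::].
  case: IHs => [W' sW'|B HB]; first by apply: vs; rewrite inE sW' orbT.
  have vW1 := vs W1 (mem_head _ _).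
  have [c0 Hc0] : exists c0, forall c, v + c *: u \in W1 -> c = c0.
    case: (classic (exists c0, v + c0 *: u \in W1)) => [[c0 Hc0]|no];
      last first.
      by exists 0 => c cW; case: no; exists c.
    exists c0 => c cW; apply/eqP; apply: contraTT vW1 => ne; rewrite negbK.
    have : (c - c0) *: u \in W1.
      have := memvB cW Hc0.
      by rewrite opprD addrACA subrr add0r -scaleNr -scalerDl.
    rewrite rpredZeq subr_eq0 (negPf ne) /= => uW1.
    by rewrite -(addrK (c *: u) v) memvB // memvZ.
  exists (c0 :: B) => c; rewrite inE negb_or => /andP [cc0 cB] W'.
  rewrite inE => /predU1P [->|]; last exact: HB.
  by apply: contraNN cc0 => /Hc0 ->.
have [c] := exists_notin (0 :: B); rewrite inE negb_or => /andP [c0 cB].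
exists (v + c *: u); first exact: PD.
move=> W'; rewrite inE => /predU1P [->|]; last exact: HB.
apply: contraNN uW => H; have := memvB H vW.
by rewrite addrC addKr rpredZeq (negPf c0).
Qed.

End InfiniteField.

(** The last clause says at once that every local factor [e i * A] has residue field K and that [x]
    generates its maximal ideal. [M] is any bound for the nilpotency of [x], not the exact index. *)
Definition serial (K : fieldType) (A : algType K) (rho : nat)
    (e : 'I_rho -> A) (x : A) (M : nat) : Prop :=
  [/\ forall i, e i != 0,
      forall i j, e i * e j = if i == j then e i else 0,
      \sum_i e i = 1,
      x ^+ M = 0
    & forall a, exists (c : 'I_rho -> K) b, a = \sum_i c i *: e i + x * b].

Definition finitely_many_unit_orbits (K : fieldType) (A : falgType K) :=
  exists s : seq A, forall a, exists2 w, w \in s &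
    exists2 u, u \is a GRing.unit & a = u * w.

(** * Primitive idempotents and the nilradical *)

Section Decomposition.
Variables (K : closedFieldType) (charK0 : [pchar K]%R =i pred0).
Variables (A : falgType K) (mulC : commutative (@GRing.mul A)).
Local Notation C := (comalg mulC).

Definition nilp (a : C) : Prop := exists k, a ^+ k = 0.

Lemma nilp0 : nilp 0. Proof. by exists 1%N; rewrite expr1. Qed.

Lemma nilpM a b : nilp b -> nilp (a * b).
Proof. by case=> k bk; exists k; rewrite exprMn bk mulr0. Qed.

Lemma nilpD a b : nilp a -> nilp b -> nilp (a + b).
Proof.
case=> k ak [l bl]; exists (k + l)%N; rewrite exprDn big1 // => i _.
case: (leqP l i) => [li|il].
  by rewrite -(subnK li) (exprD b) bl !mulr0 mul0rn.
have ki : (k <= k + l - i)%N by rewrite -addnBA ?leq_addr // ltnW.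
by rewrite -(subnK ki) (exprD a) ak mulr0 mul0r mul0rn.
Qed.

Lemma nilpZ c a : nilp a -> nilp (c *: a).
Proof. by rewrite -[c *: a]mulr_algl; apply: nilpM. Qed.

Lemma nilp_sum (I : Type) (r : seq I) (F : I -> C) :
  (forall i, nilp (F i)) -> nilp (\sum_(i <- r) F i).
Proof.
move=> H; elim/big_rec: _ => [|i a _]; first exact: nilp0.
exact: nilpD.
Qed.

(** The factor e A is local with residue field K. *)
Definition local_idempotent (e : C) :=
  forall a, exists c : K, nilp (e * (a - c%:A)).

(** A polynomial that kills [a] on e A must have two distinct roots, since otherwise some [a - c]
    would be nilpotent there; Bezout then separates the roots by an idempotent. *)
Lemma idempotent_split (e a : C) : e * e = e -> e != 0 ->
  (forall c : K, ~ nilp (e * (a - c%:A))) ->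
  exists f : C, [/\ f * f = f, e * f = f, f != 0 & f != e].
Proof.
move=> ee e0 nonil.
have [p p0 pa] : exists2 p : {poly K}, p != 0 & e * horner_alg a p = 0.
  (* In dimension [d] the powers of [a] with exponent 0 to [d] are linearly dependent. *)
  pose d := \dim {:A}.
  pose X : d.+1.-tuple C := [tuple a ^+ i | i < d.+1].
  have nf : ~~ free X.
    apply/negP => /eqP fX; have := dimvS (subvf <<X>>%VS).
    by rewrite fX size_tuple ltnn.
  have [c cs [i ci]] : exists2 c : 'I_d.+1 -> K,
      \sum_i c i *: X`_i = 0 & exists i, c i != 0.
    apply: NNPP => no; case/negP: nf; apply/freeP => c cs i.
    apply/eqP; apply/negPn/negP => ci; apply: no; exists c => //; by exists i.
  exists (\poly_(i < d.+1) (if insub i is Some j then c j else 0)).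
    apply: contraNneq ci => /(congr1 (fun p : {poly K} => p`_i)).
    by rewrite coef_poly ltn_ord coef0 valK => ->.
  rewrite (_ : horner_alg a _ = 0) ?mulr0 // -cs poly_def rmorph_sum /=.
  apply: eq_bigr => i' _; rewrite valK linearZ /= rmorphXn /= horner_algX.
  by rewrite mulr_algl (nth_map i') ?size_enum_ord // nth_ord_enum.
(* The induction drops the power of [X - r] from [p] as long as the cofactor still kills [a] on e
   A. *)
elim: {p}(size p) {-2}p (leqnn (size p)) p0 pa => [|n IH] p szp p0 pa.
  by rewrite leqn0 size_poly_eq0 (negPf p0) in szp.
have [r pr] : exists r, root p r.
  apply/closed_rootP; apply: contraNneq e0 => /eqP /size_poly1P [c c0 pc].
  move: pa; rewrite pc /= horner_algC mulr_algr => /eqP.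
  by rewrite scaler_eq0 (negPf c0).
have [k [q qr qE]] := multiplicity_XsubC p r.
case: k qE => [|k] qE.
  by rewrite qE expr0 mulr1 in pr; rewrite p0 pr in qr.
rewrite p0 /= in qr.
have q0 : q != 0 by apply: contraNneq p0 => q0; rewrite qE q0 mul0r.
have szq : (size q <= n)%N.
  move: szp; rewrite qE size_Mmonic // ?monic_exp ?monicXsubC //.
  by rewrite size_exp_XsubC addnS /= addnS ltnS; apply: leq_trans;
    rewrite leq_addr.
case: (eqVneq (e * horner_alg a q) 0) => [qa|qa]; first exact: (IH q).
have cop : coprimep (('X - r%:P) ^+ k.+1) q.
  by rewrite coprimep_expl // coprimep_sym coprimep_XsubC.
have [[u v] /= uv] := Bezout_eq1_coprimepP _ _ cop.
pose H : {rmorphism {poly K} -> C} := horner_alg a.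
have HX : H ('X - r%:P) = a - r%:A by rewrite rmorphB /= horner_algX
  horner_algC.
have UV : H u * (a - r%:A) ^+ k.+1 + H v * H q = 1.
  by rewrite -HX -rmorphXn -!rmorphM -rmorphD uv rmorph1.
have PQ : e * (H q * (a - r%:A) ^+ k.+1) = 0.
  by rewrite -HX -rmorphXn -rmorphM -qE pa.
set Q := H q in UV PQ *; set P := (a - r%:A) ^+ k.+1 in UV PQ *.
have {}qa : e * Q != 0 by [].
(* This is the component of [e] on which the power [P] of [a - r] vanishes. It is nonzero because
   [e * Q] is, and differs from [e] because no [a - c] is nilpotent on e A. *)
exists (e * (H v * Q)).
have F12 : (e * (H v * Q)) * (e * (H u * P)) = 0.
  transitivity (H v * H u * e * (e * (Q * P))); first by ring.
  by rewrite PQ mulr0.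
have F2 : e * (H u * P) = e - e * (H v * Q).
  by apply/eqP; rewrite eq_sym subr_eq -mulrDr UV mulr1.
split.
- by move: F12; rewrite F2 mulrBr => /eqP; rewrite subr_eq0 => /eqP <-;
  rewrite mulrC mulrA ee.
- by rewrite mulrA ee.
- apply: contraNneq qa => f0; rewrite -{1}(mulr1 e) -UV mulrDr f0 addr0;
  apply/eqP.
  transitivity (H u * (e * (Q * P))); first by ring.
  by rewrite PQ mulr0.
- apply/eqP => fe; apply: (nonil r); exists k.+1; rewrite exprMn -/P.
  have -> : e ^+ k.+1 = e by elim: (k) => [|l IHl]; rewrite ?expr1 // exprS IHl.
  rewrite -fe; transitivity (H v * (e * (Q * P))); first by ring.
  by rewrite PQ mulr0.
Qed.

Definition orthogonal_idempotents (s : seq C) :=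
  [/\ forall a, a \in s -> a != 0, forall a, a \in s -> a * a = a
    & pairwise (fun a b => a * b == 0) s].

(** Induction on the dimension of e A: splitting off [f] makes both f A and (e - f) A strictly
    smaller. *)
Lemma idempotent_decomposition (e : C) : e * e = e ->
  exists s : seq C, [/\ orthogonal_idempotents s, \sum_(a <- s) a = e
    & forall a, a \in s -> local_idempotent a].
Proof.
elim: {e}(\dim (limg (amull (e : A)))) {-2}e (leqnn (\dim (limg (amull (e :
  A)))))
  => [|n IH] e dime ee.
  exists [::]; split => //; rewrite big_nil.
  move: dime; rewrite leqn0 dimv_eq0 => /eqP e0.
  have : (e : A) \in limg (amull (e : A)).
    by apply/memv_imgP; exists 1; rewrite ?memvf // lfunE /= mulr1.
  by rewrite e0 memv0 => /eqP ->.
case: (eqVneq e 0) => [->|e0]; first by exists [::]; split => //;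
  rewrite big_nil.
case: (classic (local_idempotent e)) => [loc|nloc].
  exists [:: e]; split; last by move=> a; rewrite inE => /eqP ->.
    by split => // a; rewrite inE => /eqP ->.
  by rewrite big_seq1.
have [a Ha] : exists a, forall c : K, ~ nilp (e * (a - c%:A)).
  apply: NNPP => no; apply: nloc => a; apply: NNPP => no'; apply: no.
  by exists a => c Hc; apply: no'; exists c.
have [f [ff ef f0 fe]] := idempotent_split ee e0 Ha.
have smaller (g : C) : e * g = g -> g * g = g -> g != e ->
    (\dim (limg (amull (g : A))) <= n)%N.
  move=> eg gg ge; rewrite -ltnS; apply: leq_trans dime.
  have sub : (limg (amull (g : A)) <= limg (amull (e : A)))%VS.
    apply/subvP => _ /memv_imgP [u _ ->]; rewrite lfunE /=.
    apply/memv_imgP; exists (g * u : A); first exact: memvf.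
    by rewrite lfunE /=; rewrite -{1}eg; apply: esym; apply: (mulrA (e : C)).
  rewrite ltn_neqAle dimvS // andbT (dimv_leqif_sup sub);
    apply: contraNN ge => /subvP /(_ (e : A)).
  case/(_ _)/memv_imgP => [|u _].
    by apply/memv_imgP; exists 1; rewrite ?memvf // lfunE /= mulr1.
  rewrite lfunE /= => eu; apply/eqP.
  have {}eu : e = g * (u : C) by [].
  by rewrite -eg mulrC {1}eu mulrA gg -eu.
have [s [os ss ls]] := IH f (smaller f ef ff fe) ff.
have gg : (e - f) * (e - f) = e - f.
  by rewrite mulrBl !mulrBr ee ff (mulrC f) ef subrr subr0.
have eg : e * (e - f) = e - f by rewrite mulrBr ee ef.
have ge : e - f != e by rewrite -subr_eq0 addrC addKr oppr_eq0.
have [t [ot st lt]] := IH (e - f) (smaller _ eg gg ge) gg.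
(* The sum [g] of an orthogonal family fixes its members, so products across the two families vanish
   through [f * (e - f) = 0]. *)
have mulsum (r : seq C) g b : orthogonal_idempotents r ->
    \sum_(a <- r) a = g -> b \in r -> g * b = b.
  move=> [_ idr por] <- br; rewrite mulr_suml.
  elim: r idr por br => // a' r IHr idr /= /andP [/allP ar por].
  rewrite big_cons inE => /predU1P [->|br].
    rewrite idr ?mem_head // big_seq big1 ?addr0 // => c cr.
    by rewrite mulrC; apply/eqP; apply: ar.
  rewrite (eqP (ar _ br)) add0r IHr // => c cr; apply: idr.
  by rewrite inE cr orbT.
have fg0 : f * (e - f) = 0 by rewrite mulrBr mulrC ef ff subrr.
exists (s ++ t); split; last first.
- by move=> b; rewrite mem_cat => /orP [/ls|/lt].
- by rewrite big_cat /= ss st addrC subrK.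
case: (os) => ns ids ps; case: (ot) => nt idt pt; split.
- by move=> b; rewrite mem_cat => /orP [/ns|/nt].
- by move=> b; rewrite mem_cat => /orP [/ids|/idt].
rewrite pairwise_cat ps pt !andbT; apply/allrelP => b c bs ct.
rewrite -(mulsum s f b) // -(mulsum t (e - f) c) //.
apply/eqP; transitivity (f * (e - f) * (b * c)); first by ring.
by rewrite fg0 mul0r.
Qed.

Lemma finitely_many_unit_orbits_serial : finitely_many_unit_orbits A ->
  exists rho (e : 'I_rho -> C) x M, serial e x M.
Proof.
case=> orb Horb.
have [s [[ns ids ps] ss ls]] := @idempotent_decomposition 1 (mulr1 1).
have [x nx xP] : exists2 x : C, nilp x & forall a : C, nilp a -> exists b,
  a = x * b.
  apply: NNPP => no.
  (* Only nilpotent representatives are kept. If none generates all nilpotents, their ideals each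
     miss some nilpotent, so some nilpotent [v] avoids them all; but [v] is associated to a
     representative, which is then nilpotent too. *)
  pose Ws := [seq limg (amull (w : A)) | w <- orb & excluded_middle_informative
    (nilp w)].
  have [|c u v nu nv|W|v nv vs] := @subspace_avoidance _ charK0 A nilp Ws.
  - exact: nilp0.
  - by apply: nilpD => //; apply: nilpZ.
  - case/mapP => w; rewrite mem_filter => /andP [].
    case: excluded_middle_informative => //= nw _ ws ->.
    apply: NNPP => no'; apply: no; exists w => // a na.
    have : (a : A) \in limg (amull (w : A)).
      by apply/negPn/negP => aw; apply: no'; exists a.
    by case/memv_imgP => b _; rewrite lfunE => ab; exists b.
  have [w ws [u uu vE]] := Horb v.
  have wE : w = (u^-1 * v : A) by rewrite vE mulKr.
  have nw : nilp w by rewrite wE; apply: (@nilpM (u^-1 : A)).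
  have := vs (limg (amull (w : A))); case/(_ _)/negP.
    apply/mapP; exists w => //; rewrite mem_filter ws andbT.
    by case: excluded_middle_informative.
  apply/memv_imgP; exists u; first exact: memvf.
  by rewrite lfunE /= vE mulC.
have [M xM] := nx.
exists (size s), (fun i => s`_i), x, M.
have sP (i : 'I_(size s)) : s`_i \in s := mem_nth 0 (ltn_ord i).
have E2 (i j : 'I_(size s)) : (i < j)%N -> s`_i * s`_j = 0.
  by move=> ij; apply/eqP; exact: (pairwiseP 0 ps) (ltn_ord i) (ltn_ord j) ij.
have sum1 : \sum_(i < size s) s`_i = 1 by rewrite -ss (big_nth 0) big_mkord.
split => //.
- by move=> i; apply: ns; apply: sP.
- move=> i j; case: eqP => [<-|/eqP]; first by apply: ids; apply: sP.
  rewrite -val_eqE neq_ltn => /orP [/E2 //|/E2]; by rewrite mulrC.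
move=> a.
have [c Hc] : exists c : 'I_(size s) -> K, forall i : 'I_(size s),
  nilp (s`_i * (a - (c i)%:A)).
  exists (fun i => sval (constructive_indefinite_description _ (ls _ (sP i)
    a))).
  by move=> i; case: constructive_indefinite_description.
exists c.
have [|b bE] := xP (a - \sum_(i < size s) c i *: s`_i); last first.
  by exists b; rewrite -bE addrC subrK.
rewrite -{1}(mulr1 a) -sum1 mulr_sumr -sumrB; apply: nilp_sum => i.
by rewrite -mulr_algr mulrC -mulrBr.
Qed.

End Decomposition.

(** * Characters and exponential *)

Section Serial.
Variables (K : fieldType) (A : falgType K) (mulC : commutative (@GRing.mul A)).
Local Notation C := (comalg mulC).
Variables (rho : nat) (e : 'I_rho -> C) (x : C) (M : nat).
Hypothesis es : serial e x M.

Let e_neq0 : forall i, e i != 0. Proof. by case: es. Qed.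
Let e_orth : forall i j, e i * e j = if i == j then e i else 0.
Proof. by case: es. Qed.
Let e_sum : \sum_i e i = 1. Proof. by case: es. Qed.
Let xM0 : x ^+ M = 0. Proof. by case: es. Qed.

Let ee i : e i * e i = e i. Proof. by rewrite e_orth eqxx. Qed.

Lemma mulx_nil b k : (M <= k)%N -> (x * b) ^+ k = 0.
Proof. by move=> Mk; rewrite exprMn -(subnK Mk) (exprD x) xM0 mulr0 mul0r. Qed.

Let serial_split (a : C) :
  exists c : 'I_rho -> K, exists b, a = \sum_i c i *: e i + x * b.
Proof. by case: es. Qed.

Lemma sum_scale_e (c : 'I_rho -> K) j : (\sum_i c i *: e i) * e j = c j *: e j.
Proof.
rewrite mulr_suml (bigD1 j) //= -scalerAl ee big1 ?addr0 // => i /negPf ij.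
by rewrite -scalerAl e_orth ij scaler0.
Qed.

(* The residues of a at the local factors e i * A. *)
Definition chi (a : C) : 'I_rho -> K :=
  sval (constructive_indefinite_description _ (serial_split a)).

Lemma chiE a : exists b, a = \sum_i chi a i *: e i + x * b.
Proof. by rewrite /chi; case: constructive_indefinite_description. Qed.

(** This makes the chosen residues canonical. A nonzero difference of residues would put [e j] in
    xA, making a nonzero idempotent nilpotent. *)
Lemma chi_unique a c b : a = \sum_i c i *: e i + x * b -> chi a =1 c.
Proof.
move=> aE j; have [b' aE'] := chiE a.
have : (chi a j - c j) *: e j = x * ((b - b') * e j).
  move: (congr1 (fun z => z * e j) aE); rewrite {1}aE' !mulrDl !sum_scale_e.
  rewrite scalerBl; set p := chi a j *: _; set q := c j *: _ => H.
  transitivity (p + x * b' * e j - x * b' * e j - q); first by ring.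
  by rewrite H; ring.
case: (eqVneq (chi a j - c j) 0) => [/eqP|d0 H];
  first by rewrite subr_eq0 => /eqP.
case/eqP: (e_neq0 j).
have ej : e j = x * ((chi a j - c j)^-1 *: ((b - b') * e j)).
  by rewrite -scalerAr -H scalerA mulVf // scale1r.
have -> : e j = e j ^+ M.+1.
  by elim: (M) => [|k IH]; rewrite ?expr1 // exprS -IH ee.
by rewrite ej mulx_nil.
Qed.

Lemma chi_sum (c : 'I_rho -> K) : chi (\sum_i c i *: e i) =1 c.
Proof. by apply: (@chi_unique _ c 0); rewrite mulr0 addr0. Qed.

Lemma chi_linear k a b i : chi (k *: a + b) i = k * chi a i + chi b i.
Proof.
have [a' aE] := chiE a; have [b' bE] := chiE b.
apply: (@chi_unique _ (fun i => k * chi a i + chi b i) (k *: a' + b')).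
rewrite {1}aE {1}bE scalerDr scaler_sumr addrACA -big_split /= mulrDr -scalerAr.
by congr (_ + _); apply: eq_bigr => j _; rewrite scalerA scalerDl.
Qed.

Lemma chiM a b i : chi (a * b) i = chi a i * chi b i.
Proof.
have [a' aE] := chiE a; have [b' bE] := chiE b.
apply: (@chi_unique _ (fun i => chi a i * chi b i)
  ((\sum_i chi a i *: e i) * b' + a' * (\sum_i chi b i *: e i) + x * a' * b')).
set ca := \sum_i chi a i *: e i; set cb := \sum_i chi b i *: _.
have -> : \sum_j (chi a j * chi b j) *: e j = ca * cb.
  rewrite mulr_sumr; apply: eq_bigr => j _.
  by rewrite -scalerAr sum_scale_e scalerA mulrC.
by rewrite {1}aE {1}bE -/ca -/cb; ring.
Qed.

Lemma chi1 i : chi 1 i = 1.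
Proof.
rewrite -(chi_sum (fun=> 1) i) -e_sum; congr (chi _ i).
by apply: eq_bigr => j _; rewrite scale1r.
Qed.

Lemma chi_mulx b i : chi (x * b) i = 0.
Proof.
apply: (@chi_unique _ (fun=> 0) b); rewrite big1 ?add0r // => j _.
by rewrite scale0r.
Qed.

Lemma chi_e i j : chi (e i) j = (i == j)%:R.
Proof.
apply: (@chi_unique _ (fun j => (i == j)%:R) 0); rewrite mulr0 addr0.
rewrite (bigD1 i) //= eqxx scale1r big1 ?addr0 // => k /negPf ki.
by rewrite eq_sym ki scale0r.
Qed.

Lemma chi_alg k i : chi k%:A i = k.
Proof.
have := chi_linear k 1 0 i; rewrite addr0 chi1 mulr1 => ->.
by rewrite -(mulr0 x) chi_mulx addr0.
Qed.

Lemma chiD a b i : chi (a + b) i = chi a i + chi b i.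
Proof. by have := chi_linear 1 a b i; rewrite scale1r mul1r. Qed.

Lemma chi_eq0 a : (forall i, chi a i = 0) -> exists b, a = x * b.
Proof.
move=> a0; have [b aE] := chiE a; exists b; rewrite aE big1 ?add0r // => i _.
by rewrite a0 scale0r.
Qed.

Lemma unit_1mulx b : 1 + x * b \is a GRing.unit.
Proof.
apply/unitrPr; exists (\sum_(i < M) (- (x * b)) ^+ i).
rewrite -[X in (1 + X) * _]opprK; apply: oppr_inj; rewrite -mulNr opprB.
by rewrite -subrX1 -mulrN mulx_nil // sub0r.
Qed.

(** Inverting the residues gives an inverse modulo xA, and every [1 + x * b] is a unit by the
    geometric series. *)
Lemma chi_unitP a : reflect (forall i, chi a i != 0) (a \is a GRing.unit).
Proof.
apply: (iffP idP) => [ua i|H].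
  by apply: contra_eq_neq (chi1 i) => a0;
    rewrite -(mulrV ua) chiM a0 mul0r eq_sym oner_neq0.
pose v := \sum_i (chi a i)^-1 *: e i.
have [b vb] : exists b, v * a - 1 = x * b.
  apply: chi_eq0 => i; rewrite chiD -scaleN1r -[_ *: 1]/((-1)%:A) chi_alg chiM.
  by rewrite chi_sum mulVf ?subrr.
have := unit_1mulx b; rewrite -vb addrC subrK => u.
by have := unitrM v a; rewrite u => /esym/andP [].
Qed.

Lemma finitely_many_unit_orbits_of_serial : finitely_many_unit_orbits A.
Proof.
exists [seq (\sum_i x ^+ k i * e i : A) | k : {ffun 'I_rho -> 'I_M.+1}] => a.
have H i : exists k : 'I_M.+1, exists u : C,
    u \is a GRing.unit /\ (a : C) * e i = x ^+ k * u * e i.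
  (* Factors of [x] are extracted from the component of [a] until the cofactor has a nonzero
     residue, or until [m] of them have come out. *)
  have : forall m, (exists k, exists u : C, [/\ (k < m)%N, u \is a GRing.unit
      & (a : C) * e i = x ^+ k * u * e i])
      \/ exists b, (a : C) * e i = x ^+ m * b * e i.
    elim=> [|m [[k [u [km uu aE]]]|[b aE]]].
    - by right; exists a; rewrite mul1r.
    - by left; exists k, u; split => //; apply: ltnW.
    have [b' bE] := chiE b.
    have be : b * e i = ((chi b i)%:A + x * b') * e i.
      by rewrite {1}bE !mulrDl sum_scale_e mulr_algl.
    case: (eqVneq (chi b i) 0) => [c0|c0].
      right; exists b'; rewrite aE -mulrA be c0 scale0r add0r exprSr; ring.
    (* This replacement for [b] has the residue of [b] at [i] in every factor, so it is a unit of
       the whole algebra. *)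
    left; exists m, ((chi b i)%:A + x * b'); split => //; last first.
      by rewrite aE -mulrA be mulrA.
    by apply/chi_unitP => j; rewrite chiD chi_alg chi_mulx addr0.
  case/(_ M) => [[k [u [kM uu aE]]]|[b aE]].
    by exists (Ordinal (ltnW kM : (k < M.+1)%N)), u.
  (* The component is zero here, and [ord_max] stands for the exponent [M], where [x] vanishes. *)
  exists ord_max, 1; split; first exact: unitr1.
  by rewrite aE /= xM0 !mul0r.
pose k i := sval (constructive_indefinite_description _ (H i)).
have Hk i : exists u : C,
    u \is a GRing.unit /\ (a : C) * e i = x ^+ k i * u * e i.
  by rewrite /k; case: constructive_indefinite_description.
pose u i := sval (constructive_indefinite_description _ (Hk i)).
have Hu i : u i \is a GRing.unit /\ (a : C) * e i = x ^+ k i * u i * e i.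
  by rewrite /u; case: constructive_indefinite_description.
pose w : C := \sum_i x ^+ k i * e i; pose U : C := \sum_i u i * e i.
exists (w : A).
  apply/imageP; exists [ffun i => k i] => //.
  by apply: eq_bigr => i _; rewrite ffunE.
have Ue j : U * e j = u j * e j.
  rewrite mulr_suml (bigD1 j) //= -mulrA ee big1 ?addr0 // => i /negPf ij.
  by rewrite -mulrA e_orth ij mulr0.
exists (U : A); last first.
  have -> : a = \sum_j (a : C) * e j by rewrite -mulr_sumr e_sum mulr1.
  change (\sum_j (a : C) * e j = U * w); rewrite mulr_sumr;
    apply: eq_bigr => j _.
  by rewrite mulrCA Ue (Hu j).2; ring.
change (U \is a GRing.unit); apply/chi_unitP => j.
have := congr1 (chi^~ j) (Ue j); rewrite /= !chiM chi_e eqxx !mulr1 => ->.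
by move/chi_unitP: (Hu j).1; apply.
Qed.

(** The span of the [e i] is a complement of xA, on which the residues are the coordinates. *)
Lemma dim_serial : \dim {:A} = (rho + \dim (limg (amull (x : A))))%N.
Proof.
pose t : rho.-tuple A := [tuple (e i : A) | i < rho].
have tE (i : 'I_rho) : t`_i = e i.
  by rewrite (nth_map i) ?size_enum_ord // nth_ord_enum.
have sumE (c : 'I_rho -> K) : \sum_i c i *: t`_i = (\sum_i c i *: e i : C).
  by apply: eq_bigr => i _; rewrite tE.
have ft : free t.
  apply/freeP => c; rewrite sumE => c0 i.
  by have := @chi_unique 0 c 0; rewrite c0 mulr0 addr0 => /(_ erefl i) <-;
    rewrite -(mulr0 x) chi_mulx.
rewrite -[rho in RHS](size_tuple t) -(eqP ft) -dimv_disjoint_sum.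
  congr (\dim _); apply/esym/eqP; rewrite eqEsubv subvf /=; apply/subvP => a _.
  have [b aE] := chiE a; rewrite aE -sumE; apply: memv_add.
    by apply: memv_suml => i _; rewrite memvZ // memv_span // mem_nth //
      size_tuple.
  by apply/memv_imgP; exists (b : A); rewrite ?memvf // lfunE.
apply/eqP; rewrite -subv0; apply/subvP => a; rewrite memv_cap => /andP [at_].
case/memv_imgP => b _; rewrite lfunE /= => ab.
have aE := coord_span at_; rewrite sumE in aE.
have H := @chi_unique a (fun i => coord t i a) 0.
rewrite memv0 aE big1 // => i _; rewrite -H; last by rewrite mulr0 addr0.
by rewrite ab chi_mulx scale0r.
Qed.

Section Exponential.
Hypothesis charK0 : [pchar K]%R =i pred0.

(* Two superfluous terms make the terms of degree 0 and 1 always present. *)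
Definition nilexp (y : C) : C := \sum_(k < M.+2) (k`!%:R^-1 : K) *: y ^+ k.

Lemma nilexp_expand y : exists c, nilexp y = 1 + y + y ^+ 2 * c.
Proof.
rewrite /nilexp big_ord_recl big_ord_recl /= !fact0 expr0 invr1 !scale1r expr1.
exists (\sum_(i < M) (i.+2`!%:R^-1 : K) *: y ^+ i); rewrite addrA mulr_sumr.
congr (_ + _); apply: eq_bigr => i _.
by rewrite /bump /= !add1n -scalerAr -exprD.
Qed.

(** The exponentials are values at 1 of the polynomials [p u]. Below degree [M.+2] the coefficients
    of the product match by the binomial formula; from there on they contain a power of [x] beyond
    [M]. *)
Lemma nilexpD a b : nilexp (x * a + x * b) = nilexp (x * a) * nilexp (x * b).
Proof.
set y := x * a; set z := x * b.
pose p (u : C) := \poly_(k < M.+2) ((k`!%:R^-1 : K) *: u ^+ k).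
have pE u : nilexp u = (p u).[1].
  by rewrite horner_poly; apply: eq_bigr => i _; rewrite expr1n mulr1.
rewrite !pE -hornerM.
rewrite (@horner_coef_wide _ (M.+2 + M.+2) (p y * p z)); last first.
  apply: leq_trans (size_polyMleq _ _) _; apply: leq_trans (leq_pred _) _.
  by apply: leq_add; apply: size_poly.
rewrite big_split_ord /= [X in _ = _ + X]big1 ?addr0; last first.
  move=> k _; rewrite coefM big1 ?mul0r // => i _; rewrite !coef_poly.
  case: ifP => _; last by rewrite mul0r.
  case: ifP => _; last by rewrite mulr0.
  rewrite -scalerAl -scalerAr !exprMn.
  have -> : x ^+ i * a ^+ i * (x ^+ (M.+2 + k - i) * b ^+ (M.+2 + k - i)) =
            x ^+ (i + (M.+2 + k - i)) * (a ^+ i * b ^+ (M.+2 + k - i)).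
    by rewrite exprD; ring.
  rewrite subnKC; last by rewrite -ltnS.
  have -> : x ^+ (M.+2 + k) = 0.
    by rewrite !addSn -!addnS exprD xM0 mul0r.
  by rewrite mul0r !scaler0.
rewrite -pE /nilexp; apply: eq_bigr => k _.
rewrite expr1n mulr1 coefM exprDn scaler_sumr (reindex_inj rev_ord_inj) /=.
apply: eq_bigr => i _; rewrite subSS.
have ik : (i <= k)%N by rewrite -ltnS.
have kM : (k < M.+2)%N by [].
rewrite !coef_poly (leq_ltn_trans ik kM) (leq_ltn_trans (leq_subr _ _) kM).
rewrite subKn // bin_sub // -scalerAl -scalerAr scalerA -scaler_nat scalerA.
congr (_ *: _).
have f0 n : (n`!%:R : K) != 0 by rewrite ((pcharf0P K).1 charK0) -lt0n fact_gt0.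
have := congr1 (fun n => n%:R : K) (bin_fact ik); rewrite !natrM => H.
apply: (mulfI (f0 k)); rewrite mulrA mulfV // mul1r -H.
by field; rewrite !f0.
Qed.

Lemma nilexp0 : nilexp 0 = 1.
Proof. by have [c ->] := nilexp_expand 0; rewrite expr2 !mul0r !addr0. Qed.

Lemma nilexpVN a : nilexp (x * a) * nilexp (- (x * a)) = 1.
Proof. by rewrite -mulrN -nilexpD mulrN subrr nilexp0. Qed.

(** It suffices to treat [nilexp y = 1] with [y] in xA: there [y] times a unit of the form
    [1 + x * b] is zero. *)
Lemma nilexp_inj a b : nilexp (x * a) = nilexp (x * b) -> x * a = x * b.
Proof.
move=> ab; apply/eqP; rewrite -subr_eq0; set y := _ - _.
have yE : y = x * (a - b) by rewrite mulrBr.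
have : nilexp y = 1.
  by rewrite yE mulrBr -mulrN nilexpD ab mulrN nilexpVN.
have [c ->] := nilexp_expand y; rewrite -addrA -[RHS]addr0 => /addrI.
rewrite (_ : y + _ = (1 + x * ((a - b) * c)) * y); last by rewrite yE; ring.
by move/(congr1 (fun z => (1 + x * ((a - b) * c))^-1 * z));
  rewrite mulr0 mulKr ?unit_1mulx // => ->.
Qed.

(** Successive approximation replaces the logarithm series: the error [1 + y] is absorbed by the
    factor [nilexp y], which leaves an error of higher order in [x]. *)
Lemma nilexp_surj b : exists a, nilexp (x * a) = 1 + x * b.
Proof.
have : forall k, exists a c, 1 + x * b = nilexp (x * a) * (1 + x ^+ k.+1 * c).
  elim=> [|k [a [c IH]]].
    by exists 0, b; rewrite mulr0 nilexp0 mul1r expr1.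
  set y := x ^+ k.+1 * c in IH.
  have [d dE] := nilexp_expand (- y).
  (* The new error is read off from (1 + y)(1 - y + y^2 d) = 1 + y^2 (d - 1 + y d), where y^2
     contains x^(2k+2). *)
  exists (a + x ^+ k * c), (x ^+ k * c ^+ 2 * (d - 1 + y * d)).
  have yE : y = x * (x ^+ k * c) by rewrite mulrA -exprS.
  rewrite (mulrDr x) nilexpD -yE IH -mulrA; congr (_ * _).
  have V := nilexpVN (x ^+ k * c); rewrite -yE in V.
  transitivity (nilexp y * nilexp (- y) * (1 + y)); first by rewrite V mul1r.
  rewrite -mulrA; congr (_ * _).
  by rewrite dE /y !exprS; ring.
case/(_ M) => a [c ->]; exists a.
by rewrite exprS xM0 mulr0 mul0r addr0 mulr1.
Qed.

Lemma chi_nilexp a i : chi (nilexp (x * a)) i = 1.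
Proof.
have [c ->] := nilexp_expand (x * a).
rewrite (_ : _ + _ + _ = 1 + x * (a + x * a ^+ 2 * c)); last by ring.
by rewrite chiD chi1 chi_mulx addr0.
Qed.

End Exponential.
End Serial.

(** * Generators *)

Section ProdXsubCExp.
Variables (K : fieldType) (r : nat).
Implicit Types (lam : 'I_r -> K) (m : 'I_r -> nat).

Definition prodXsubCexp lam m : {poly K} := \prod_i ('X - (lam i)%:P) ^+ m i.

Lemma prodXsubCexp_monic lam m : prodXsubCexp lam m \is monic.
Proof. by apply: monic_prod => i _; rewrite monic_exp // monicXsubC. Qed.

Lemma size_prodXsubCexp lam m : size (prodXsubCexp lam m) = (\sum_i m i).+1.
Proof.
rewrite /prodXsubCexp; elim/big_rec2: _ => [|i k p _ IH];
  first by rewrite size_poly1.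
rewrite size_monicM ?monic_exp ?monicXsubC //.
  by rewrite IH size_exp_XsubC addSn addnS.
by rewrite -size_poly_eq0 IH.
Qed.

Lemma prodXsubCexpD1 lam m j : injective lam ->
  exists2 q, prodXsubCexp lam m = ('X - (lam j)%:P) ^+ m j * q
    & ~~ root q (lam j) /\ (forall i, i != j -> ('X - (lam i)%:P) ^+ m i %| q).
Proof.
move=> injl; rewrite /prodXsubCexp (bigD1 j) //=.
set q := \prod_(i | _) _; exists q => //; split.
  rewrite /root horner_prod; apply/prodf_neq0 => i ij.
  by rewrite !hornerE expf_neq0 // subr_eq0 (inj_eq injl) eq_sym.
by move=> i ij; rewrite /q (bigD1 i) //= dvdp_mulr.
Qed.

Lemma coprime_XsubCexp (q : {poly K}) c k :
  ~~ root q c -> coprimep (('X - c%:P) ^+ k) q.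
Proof. by move=> qc; rewrite coprimep_expl // coprimep_sym coprimep_XsubC. Qed.

Lemma prodXsubCexp_dvd lam m p : injective lam ->
  (forall i, ('X - (lam i)%:P) ^+ m i %| p) -> prodXsubCexp lam m %| p.
Proof.
move=> injl H; rewrite /prodXsubCexp.
elim: (index_enum _) (index_enum_uniq 'I_r) => [|i s IH] /=.
  by rewrite big_nil dvd1p.
case/andP => ins Us; rewrite big_cons Gauss_dvdp ?H ?IH //.
apply: coprime_XsubCexp; rewrite /root horner_prod prodf_seq_neq0.
apply/allP => j js /=; rewrite !hornerE expf_neq0 // subr_eq0 (inj_eq injl).
by apply: contraNneq ins => ->.
Qed.

(** Lifts of the idempotents of the Chinese remainder theorem. *)
Lemma prodXsubCexp_crt lam m : injective lam ->
  exists p : 'I_r -> {poly K}, forall i j,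
    ('X - (lam j)%:P) ^+ m j %| p i - (i == j)%:R.
Proof.
move=> injl.
have H i : exists p : {poly K}, forall j,
    ('X - (lam j)%:P) ^+ m j %| p - (i == j)%:R.
  have [q _ [qi qj]] := prodXsubCexpD1 m i injl.
  have /Bezout_eq1_coprimepP [[u v] /= uv] := coprime_XsubCexp (m i) qi.
  exists (v * q) => j; case: eqP => [<-|/eqP ij].
    by rewrite mulr1n -uv opprD addrCA subrr addr0 -mulNr dvdp_mull.
  by rewrite mulr0n subr0 dvdp_mull // qj // eq_sym.
exists (fun i => sval (constructive_indefinite_description _ (H i))) => i.
by case: constructive_indefinite_description.
Qed.

(** Distinctness is assumed of [lam] only, since [lam'] will be the values h(b_j). Each [lam i] is
    some [lam' j]; this matching is injective on a finite set, hence bijective, which forces [lam']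
    to be injective and lets root multiplicities be compared. *)
Lemma prodXsubCexp_inj lam lam' m m' : injective lam ->
  (forall i, 0 < m i)%N -> prodXsubCexp lam m = prodXsubCexp lam' m' ->
  exists2 s : 'I_r -> 'I_r, injective s & forall i, m i = m' (s i).
Proof.
move=> injl m0 E.
have H i : exists j, lam' j == lam i.
  have : root (prodXsubCexp lam' m') (lam i).
    have [q qE _] := prodXsubCexpD1 m i injl.
    rewrite -E qE rootM; apply/orP; left.
    by rewrite /root !hornerE subrr expr0n; case: (m i) (m0 i).
  rewrite /root horner_prod => /eqP; move/eqP/prodf_eq0 => [j _].
  rewrite !hornerE expf_eq0 => /andP [_]; rewrite subr_eq0 => /eqP ->.
  by exists j.
pose s i := xchoose (H i).
have sE i : lam' (s i) = lam i by apply/eqP; apply: (xchooseP (H i)).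
have injs : injective s.
  by move=> i j ij; apply: injl; rewrite -!sE ij.
have injl' : injective lam'.
  have [t st ts] := injF_bij injs.
  by move=> i j; rewrite -(ts i) -(ts j) !sE => /injl ->.
exists s => // i.
have mupE (l : 'I_r -> K) (k : 'I_r -> nat) j : injective l ->
    mup (l j) (prodXsubCexp l k) = k j.
  move=> injl0; have [q -> [qj _]] := prodXsubCexpD1 k j injl0.
  by rewrite mupMl // mup_XsubCX eqxx.
by rewrite -(mupE lam m) // E -sE mupE.
Qed.

End ProdXsubCExp.

(** That is, A is K[X]/(h) with [y] the class of X. *)
Definition monogenic (K : fieldType) (A : algType K) (y : A) (h : {poly K}) :=
  (forall a, exists p, a = horner_alg y p) /\
  (forall p, horner_alg y p = 0 <-> h %| p).

Section SerialMonogenic.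
Variables (K : fieldType) (A : falgType K) (mulC : commutative (@GRing.mul A)).
Local Notation C := (comalg mulC).

Section FromSerial.
Variables (rho : nat) (e : 'I_rho -> C) (x : C) (M : nat).
Hypothesis es : serial e x M.

Let mult_exists i : exists k, x ^+ k * e i == 0.
Proof. by exists M; case: es => _ _ _ -> _; rewrite mul0r. Qed.

Definition local_length i : nat := ex_minn (mult_exists i).

Lemma local_lengthP i : x ^+ local_length i * e i = 0.
Proof. by rewrite /local_length; case: ex_minnP => k /eqP. Qed.

Lemma local_length_min i k : x ^+ k * e i = 0 -> (local_length i <= k)%N.
Proof.
by rewrite /local_length; case: ex_minnP => m _ H /eqP /H.
Qed.

Lemma local_length_gt0 i : (0 < local_length i)%N.
Proof.
rewrite lt0n; apply/eqP => l0; have := local_lengthP i.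
by rewrite l0 mul1r => /eqP; apply/negP; case: es.
Qed.

Lemma serial_monogenic lam : injective lam ->
  monogenic (\sum_i lam i *: e i + x : A) (prodXsubCexp lam local_length).
Proof.
move=> injl; have [_ e_orth e_sum xM e_split] := es.
pose y : C := \sum_i lam i *: e i + x.
(* On the factor of [e i] the element [y] acts as [z i], so a polynomial in [y] can be studied one
   root at a time. *)
pose z i : C := (lam i)%:A + x.
have yz i : y * e i = z i * e i.
  by rewrite !mulrDl (sum_scale_e es) mulr_algl.
have evz p i : horner_alg y p * e i = horner_alg (z i) p * e i.
  elim/poly_ind: p => [|p c IH]; first by rewrite !rmorph0.
  rewrite !rmorphD !rmorphM /= !horner_algX !horner_algC !mulrDl.
  by rewrite mulrAC IH -!mulrA (mulrC (e i)) yz.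
have evzX i k : horner_alg (z i) (('X - (lam i)%:P) ^+ k) = x ^+ k.
  by rewrite rmorphXn rmorphB /= horner_algX horner_algC addrAC subrr add0r.
have evu p i : exists b, horner_alg (z i) p = (p.[lam i])%:A + x * b.
  have /factor_theorem [q qE] : root (p - (p.[lam i])%:P) (lam i).
    by rewrite /root !hornerE subrr.
  exists (horner_alg (z i) q).
  rewrite -[p in LHS](subrK (p.[lam i])%:P) qE rmorphD rmorphM /= horner_algC.
  by rewrite -['X - _]expr1 evzX expr1 addrC mulrC.
have sumE (a b : C) : (forall i, a * e i = b * e i) -> a = b.
  move=> H; rewrite -[a]mulr1 -[b]mulr1 -e_sum !mulr_sumr.
  exact: eq_bigr.
split; last first.
  move=> p; split=> [p0|/dvdpP [q ->]].
    apply: prodXsubCexp_dvd => // i.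
    case: (eqVneq p 0) => [->|p_neq0]; first exact: dvdp0.
    (* The cofactor [q] does not vanish at [lam i], so its value at [z i] is a unit; hence [x ^+ k]
       kills [e i], and [k] is at least the local length. *)
    have [k [q]] := multiplicity_XsubC p (lam i); rewrite p_neq0 /= => qi pE.
    rewrite pE dvdp_mull // dvdp_exp2l // local_length_min //.
    have := congr1 (fun a : C => a * e i) p0; rewrite /= (evz p i) mul0r.
    rewrite pE rmorphM /= evzX -mulrA => H.
    have [b bE] := evu q i.
    have u : horner_alg (z i) q \is a GRing.unit.
      rewrite bE; apply/(chi_unitP es) => j.
      by rewrite (chiD es) (chi_alg es) (chi_mulx es) addr0.
    by rewrite -[LHS](mulKr u) H mulr0.
  apply: (sumE (horner_alg y (q * prodXsubCexp lam local_length)) 0) => i.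
  rewrite mul0r evz rmorphM /=.
  have [q' -> _] := prodXsubCexpD1 local_length i injl.
  rewrite rmorphM /= evzX.
  transitivity (horner_alg (z i) q * horner_alg (z i) q' *
    (x ^+ local_length i * e i)); first by ring.
  by rewrite local_lengthP mulr0.
(* With all exponents equal to [M] these polynomials take the value [e i] at [y], so [x] is a
   polynomial in [y] as well. *)
have [p pE] := prodXsubCexp_crt (fun=> M) injl.
have pe i : horner_alg y (p i) = e i.
  apply: sumE => j; rewrite e_orth evz.
  have /dvdpP [q qE] := pE i j.
  have -> : p i = q * ('X - (lam j)%:P) ^+ M + (i == j)%:R by rewrite -qE subrK.
  rewrite rmorphD rmorphM /= evzX xM mulr0 add0r; case: eqP => [->|_].
    by rewrite mulr1n rmorph1 mul1r.
  by rewrite mulr0n rmorph0 mul0r.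
have psum c : horner_alg y (\sum_i c i *: p i) = \sum_i c i *: e i.
  rewrite rmorph_sum; apply: eq_bigr => i _ /=.
  by rewrite -mul_polyC rmorphM /= horner_algC mulr_algl pe.
pose px := 'X - \sum_i lam i *: p i.
have pxE : horner_alg y px = x.
  by rewrite rmorphB /= horner_algX psum /y addrAC subrr add0r.
(* [a] is expanded in powers of [x] with coefficients in the span of the [e i]; the remainder
   disappears at [k = M]. *)
move=> a; suff : forall k, exists q b, (a : C) = horner_alg y q + x ^+ k * b.
  by move=> /(_ M) [q [b ->]]; exists q; rewrite xM mul0r addr0.
elim=> [|k [q [b aE]]]; first by exists 0, a; rewrite rmorph0 add0r mul1r.
have [c [b' bE]] := e_split b.
exists (q + px ^+ k * \sum_i c i *: p i), b'.
rewrite aE bE rmorphD rmorphM rmorphXn /= pxE psum.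
by rewrite exprSr mulrDr mulrA addrA.
Qed.

End FromSerial.

Lemma monogenic_serial r (lam : 'I_r -> K) (m : 'I_r -> nat) (y : A) :
  injective lam -> (forall i, 0 < m i)%N -> monogenic y (prodXsubCexp lam m) ->
  exists (e : 'I_r -> C) x M, serial e x M.
Proof.
move=> injl m0 [sur ker]; have [p pE] := prodXsubCexp_crt m injl.
pose H : {rmorphism {poly K} -> C} := horner_alg (y : C).
have HZ c q : H (c *: q) = c *: H q.
  by rewrite -mul_polyC rmorphM /= horner_algC mulr_algl.
have zero q : (forall j, ('X - (lam j)%:P) ^+ m j %| q) -> H q = 0.
  by move=> Hq; apply/ker; apply: prodXsubCexp_dvd.
have pj i j : exists w, p i = w * ('X - (lam j)%:P) ^+ m j + (i == j)%:R.
  by have /dvdpP [w wE] := pE i j; exists w; rewrite -wE subrK.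
have dvd1 i q : ('X - (lam i)%:P) ^+ m i %| q -> root q (lam i).
  case/dvdpP => w ->; rewrite rootM; apply/orP; right.
  by rewrite /root !hornerE subrr expr0n; case: (m i) (m0 i).
(* The product of the distinct linear factors generates the nilradical; the sum of the
   multiplicities is a crude exponent that works for all factors at once. *)
exists (fun i => H (p i)), (H (\prod_i ('X - (lam i)%:P))), (\sum_i m i)%N;
  split.
- move=> i; apply/eqP => /ker hp; have [w wE] := pj i i.
  have : root (p i) (lam i).
    apply: dvd1; apply: dvdp_trans hp.
    by have [q -> _] := prodXsubCexpD1 m i injl; rewrite dvdp_mulr.
  rewrite wE eqxx /root !hornerE subrr expr0n.
  by case: (m i) (m0 i) => // k _; rewrite mulr0 add0r oner_eq0.
- move=> i j; apply/eqP; rewrite -subr_eq0; apply/eqP.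
  transitivity (H (p i * p j - (i == j)%:R * p i)).
    rewrite rmorphB !rmorphM /= rmorph_nat; congr (_ - _).
    by case: eqP; rewrite ?mul1r ?mul0r.
  apply: zero => k; have [u uE] := pj i k; have [v vE] := pj j k.
  set P := _ ^+ _ in uE vE *.
  have -> : p i * p j - (i == j)%:R * p i = P * (u * v * P + u * (j == k)%:R
      + v * (i == k)%:R - (i == j)%:R * u) +
      ((i == k)%:R * (j == k)%:R - (i == j)%:R * (i == k)%:R).
    by rewrite uE vE; ring.
  rewrite (_ : (i == k)%:R * (j == k)%:R - _ = 0) ?addr0 ?dvdp_mulr //.
  by case: (eqVneq i k) => [->|_]; rewrite ?mul0r ?mulr0 ?subrr // mul1r mulr1
    (eq_sym j) subrr.
- rewrite -rmorph_sum -(rmorph1 H); apply/eqP; rewrite -subr_eq0 -rmorphB.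
  apply/eqP; apply: zero => k.
  have -> : \sum_i p i - 1 = \sum_i (p i - (i == k)%:R).
    rewrite sumrB; congr (_ - _); rewrite (bigD1 k) //= eqxx big1 ?addr0 //.
    by move=> i /negPf ->.
  by elim/big_ind: _ => // u v Hu Hv; rewrite dvdp_addr.
- rewrite -rmorphXn; apply: zero => k.
  rewrite -prodrXl (bigD1 k) //= dvdp_mulr // dvdp_exp2l //.
  by rewrite (bigD1 k) //= leq_addr.
move=> a; have [q aE] := sur a.
(* Interpolating [q] at the roots gives the residues; the difference vanishes at every root, so its
   class is a multiple of [x]. *)
have : prodXsubCexp lam (fun=> 1%N) %| q - \sum_i q.[lam i] *: p i.
  apply: prodXsubCexp_dvd => // j; rewrite expr1 dvdp_XsubCl /root !hornerE.
  rewrite horner_sum (bigD1 j) //= big1 => [|i /negPf ij]; last first.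
    by rewrite !hornerE (eqP (dvd1 j _ (_ : _ %| p i))) ?mulr0 //;
      have := pE i j; rewrite ij subr0.
  have := eqP (dvd1 j _ (pE j j)); rewrite eqxx !hornerE => /eqP.
  by rewrite subr_eq0 => /eqP ->; rewrite mulr1 subrr.
case/dvdpP => w wE; exists (fun i => q.[lam i]), (H w).
rewrite aE -[q in LHS](subrK (\sum_i q.[lam i] *: p i)) wE rmorphD rmorphM /=
  addrC mulrC.
rewrite -[horner_alg y]/(H : _ -> _) rmorph_sum /=; congr (_ + _).
  by apply: eq_bigr => i _; rewrite HZ.
Qed.

End SerialMonogenic.

(** * Quotients of the polynomial ring and equivalence of images *)

Section EquivalentImages.
Variable K : fieldType.
Implicit Types V W U : vectType K.

Lemma bij_lfunK V W (L : 'Hom(V, W)) : bijective L ->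
  cancel L (L^-1)%VF /\ cancel (L^-1)%VF L.
Proof.
move=> bL; have kL : lker L == 0%VS by apply/lker0P; apply: bij_inj.
split; first exact: lker0_lfunK.
have [g _ gK] := bL => w; apply: limg_lfunVK.
by apply/memv_imgP; exists (g w); rewrite ?memvf ?gK.
Qed.

(** Conjugation is restated as an intertwining identity, which can be checked on vectors without the
    inverse of [L]. *)
Lemma conj_lfunP V W (L : 'Hom(V, W)) (h : 'End(V)) (h' : 'End(W)) :
  bijective L -> h' = (L \o h \o L^-1)%VF <-> forall v, h' (L v) = L (h v).
Proof.
move=> /bij_lfunK [LK KL]; split=> [-> v|H];
  first by rewrite !lfunE /= !lfunE /= LK.
by apply/lfunP => w; rewrite !lfunE /= !lfunE /= -H KL.
Qed.

Lemma equivalent_images_sym V W (H : 'End(V) -> Prop) (H' : 'End(W) -> Prop) :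
  equivalent_images H H' -> equivalent_images H' H.
Proof.
case=> L bL HH; have [LK KL] := bij_lfunK bL.
have bL' : bijective (L^-1)%VF by exists L.
exists (L^-1)%VF => // h; split=> [Hh|[h' /HH [h0 Hh0 /(conj_lfunP _ _ bL)
  E0]]].
  exists (L \o h \o L^-1)%VF; first by apply/HH; exists h.
  by apply/conj_lfunP => // w; rewrite !lfunE /= !lfunE /= LK.
move/(conj_lfunP _ _ bL') => E; suff -> : h = h0 by [].
by apply/lfunP => v; rewrite -[in LHS](LK v) E E0 LK.
Qed.

Lemma equivalent_images_trans V W U (H : 'End(V) -> Prop)
    (H' : 'End(W) -> Prop) (H2 : 'End(U) -> Prop) :
  equivalent_images H H' -> equivalent_images H' H2 -> equivalent_images H H2.
Proof.
case=> L bL HH [L' bL' HH'].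
have bL2 : bijective (L' \o L)%VF.
  apply: (eq_bij (bij_comp bL' bL)) => v; by rewrite lfunE.
exists (L' \o L)%VF => // h2; split.
  case/HH' => h' /HH [h Hh /(conj_lfunP _ _ bL) E] /(conj_lfunP _ _ bL') E'.
  by exists h => //; apply/conj_lfunP => // v; rewrite !lfunE /= E' E.
case=> h Hh /(conj_lfunP _ _ bL2) E; apply/HH'.
exists (L \o h \o L^-1)%VF; first by apply/HH; exists h.
have [LK KL] := bij_lfunK bL.
apply/conj_lfunP => // w; have := E ((L^-1)%VF w); rewrite !lfunE /= KL => ->.
by rewrite [in RHS]lfunE.
Qed.

Lemma dim_bij V W (L : 'Hom(V, W)) : bijective L -> \dim {:V} = \dim {:W}.
Proof.
move=> bL; have [LK KL] := bij_lfunK bL.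
rewrite -(@limg_dim_eq _ _ _ L); last first.
  by apply/eqP; rewrite -subv0; apply: subv_trans (capvSr _ _) _;
    rewrite subv0; apply/lker0P/bij_inj.
congr (\dim _); apply/eqP; rewrite eqEsubv subvf; apply/subvP => w _.
by apply/memv_imgP; exists ((L^-1)%VF w); rewrite ?memvf ?KL.
Qed.

Lemma amullE (A : falgType K) (a v : A) : amull a v = a * v.
Proof. by rewrite lfunE. Qed.

Lemma algebra_image_iso (A B : falgType K) (phi : {lrmorphism A -> B}) :
  bijective phi -> equivalent_images (@algebra_image K A) (@algebra_image K B).
Proof.
case=> psi phiK psiK; have fE a : linfun phi a = phi a by rewrite lfunE.
have bL : bijective (linfun phi).
  by exists psi => a; rewrite fE ?phiK ?psiK.
exists (linfun phi) => // h'; split.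
  case=> b ub ->; exists (amull (psi b)); last first.
    by apply/conj_lfunP => // v; rewrite !fE !amullE rmorphM /= psiK.
  exists (psi b) => //; apply/unitrP; exists (psi b^-1).
  by split; apply: (can_inj phiK); rewrite rmorphM rmorph1 /= !psiK ?mulVr
    ?mulrV.
case=> _ [a ua ->] /(conj_lfunP _ _ bL) E; exists (phi a);
  first exact: rmorph_unit.
by apply/lfunP => b; rewrite -(psiK b) -fE E !amullE !fE rmorphM.
Qed.

(** [L] carries multiplications by units to multiplications by units but need not send 1 to 1.
    Precomposing it with multiplication by the preimage [w] of 1 corrects this; multiplicativity
    holds on units and spreads to sums of two units. *)
Lemma algebra_image_lrmorphism (A B : falgType K) :
  (forall a : A, exists u v, [/\ u \is a GRing.unit,
    v \is a GRing.unit & a = u + v]) ->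
  equivalent_images (@algebra_image K A) (@algebra_image K B) ->
  exists phi : {lrmorphism A -> B}, injective phi.
Proof.
move=> span [L bL HH]; have [LK KL] := bij_lfunK bL.
pose w : A := (L^-1)%VF (1 : B); pose phi (a : A) : B := L (a * w).
have phiD : linear phi.
  by move=> k a b; rewrite /phi mulrDl -scalerAl linearP.
have phiU u : u \is a GRing.unit -> forall v, phi u * L v = L (u * v).
  move=> uu; have : algebra_image (L \o amull u \o L^-1)%VF.
    by apply/HH; exists (amull u) => //; exists u.
  case=> b ub /esym/(conj_lfunP _ _ bL) E v.
  have {}E v' : b * L v' = L (u * v') by have := E v'; rewrite !amullE.
  by rewrite -E /phi -E KL mulr1.
have phiE a v : phi a * L v = L (a * v).
  have [u [u' [uu uu' ->]]] := span a.
  have := phiD 1 u u'; rewrite !scale1r => ->.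
  by rewrite !mulrDl linearD /= !phiU.
have phi1 : phi 1 = 1 by rewrite /phi mul1r KL.
have phiM a b : phi (a * b) = phi a * phi b.
  by rewrite /phi -mulrA -phiE.
pose f1 := GRing.isSemilinear.Build K A B _ phi (GRing.semilinear_linear phiD).
pose f2 := GRing.isMonoidMorphism.Build A B phi (conj phi1 phiM).
pose f : {lrmorphism A -> B} := HB.pack phi f1 f2.
exists f; apply: raddf_inj => a a0.
apply: (bij_inj bL); rewrite linear0 -[a]mulr1 -phiE -[phi a]/(f a) a0 mul0r.
by [].
Qed.

End EquivalentImages.

Section Quotients.
Variables (K : fieldType).

Lemma in_qpoly_eq0 (h p : {poly K}) : h \is monic -> (1 < size h)%N ->
  in_qpoly h p = 0 <-> h %| p.
Proof.
move=> mh sh; have mkE : mk_monic h = h by rewrite /mk_monic sh mh.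
have E : val (in_qpoly h p) = p %% h.
  by rewrite /= mkE Pdiv.IdomainMonic.modpE.
split=> [p0|hp]; first by rewrite /dvdp -E p0.
by apply: val_inj; rewrite E; apply/eqP.
Qed.

Lemma in_qpolyK (h : {poly K}) (q : {poly %/ h}) : in_qpoly h (val q) = q.
Proof. by apply: val_inj; apply: in_qpoly_small; apply: size_mk_monic. Qed.

Lemma isomorphic_to_quotientP (A : falgType K) (f : {poly K}) :
  (1 < size f)%N -> isomorphic_to_quotient A f <-> exists y : A, monogenic y f.
Proof.
move=> sf; rewrite /isomorphic_to_quotient; set h := _ *: f.
have f0 : f != 0 by rewrite -size_poly_gt0 ltnW.
have l0 : (lead_coef f)^-1 != 0 by rewrite invr_eq0 lead_coef_eq0.
have sh : (1 < size h)%N by rewrite size_scale.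
have mh : h \is monic by rewrite monicE lead_coefZ mulVf // lead_coef_eq0.
have hf p : h %| p = (f %| p) by rewrite dvdpZl.
split.
  case=> phi [psi phiK psiK].
  have ev p : phi (horner_alg (psi (qpolyX h)) p) = in_qpoly h p.
    elim/poly_ind: p => [|p c IH]; first by rewrite !rmorph0.
    rewrite !rmorphD !rmorphM /= IH horner_algX horner_algC psiK linearZ /=
      rmorph1.
    by congr (_ + _); rewrite -[c%:P]alg_polyC linearZ /= rmorph1.
  exists (psi (qpolyX h)); split=> [a|p].
    by exists (val (phi a)); apply: (can_inj phiK); rewrite ev in_qpolyK.
  rewrite -hf -(in_qpoly_eq0 p mh sh) -ev; split=> [->|];
    first by rewrite rmorph0.
  by rewrite -[X in _ = X -> _](rmorph0 phi) => /(can_inj phiK).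
case=> y [sur ker].
pose P a := sval (constructive_indefinite_description _ (sur a)).
have PE a : a = horner_alg y (P a).
  by rewrite /P; case: constructive_indefinite_description.
pose phi a : {poly %/ h} := in_qpoly h (P a).
have phiE p : phi (horner_alg y p) = in_qpoly h p.
  apply/eqP; rewrite -subr_eq0 -rmorphB; apply/eqP; apply/in_qpoly_eq0 => //.
  by rewrite hf; apply/ker; rewrite rmorphB /= -PE subrr.
have HZ c p : horner_alg y (c *: p) = c *: horner_alg y p.
  by rewrite -mul_polyC rmorphM /= horner_algC mulr_algl.
have phiL : linear phi.
  move=> c a b; rewrite {1}(PE a) {1}(PE b) -HZ -rmorphD phiE.
  by rewrite linearP.
have phi1 : phi 1 = 1 by rewrite -(rmorph1 (horner_alg y)) phiE rmorph1.
have phiM a b : phi (a * b) = phi a * phi b.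
  by rewrite {1}(PE a) {1}(PE b) -rmorphM phiE rmorphM.
pose f1 := GRing.isSemilinear.Build K A {poly %/ h} _ phi
  (GRing.semilinear_linear phiL).
pose f2 := GRing.isMonoidMorphism.Build A {poly %/ h} phi (conj phi1 phiM).
pose g : {lrmorphism A -> {poly %/ h}} := HB.pack phi f1 f2.
exists g; exists (fun q => horner_alg y (val q)) => [a|q].
  apply/eqP; rewrite -subr_eq0 {2}(PE a) -rmorphB; apply/eqP/ker.
  rewrite -hf; apply/in_qpoly_eq0 => //; rewrite rmorphB.
  by apply/eqP; rewrite subr_eq0; apply/eqP; apply: in_qpolyK.
by rewrite -[g _]/(phi _) phiE in_qpolyK.
Qed.

Lemma dim_monogenic (A : falgType K) (y : A) (h : {poly K}) :
  (1 < size h)%N -> monogenic y h -> \dim {:A} = (size h).-1.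
Proof.
move=> sh mono; have h0 : h != 0 by rewrite -size_poly_gt0 ltnW.
have [|phi bphi] := (isomorphic_to_quotientP A sh).2; first by exists y.
have bL : bijective (linfun phi).
  by apply: (eq_bij bphi) => a; rewrite lfunE.
rewrite (dim_bij bL) dim_polyn /mk_monic size_scale ?invr_eq0 ?lead_coef_eq0 //
  sh.
rewrite monicE lead_coefZ mulVf ?lead_coef_eq0 // eqxx /=.
by rewrite size_scale // invr_eq0 lead_coef_eq0.
Qed.

Lemma monogenic_lrmorphism (A B : falgType K) (y : A) (z : B) (r : nat)
    (lam lam' : 'I_r -> K) (m m' : 'I_r -> nat) (phi : {lrmorphism A -> B}) :
  injective phi -> injective lam -> (forall i, 0 < m i)%N ->
  (\sum_i m i = \sum_i m' i)%N ->
  monogenic y (prodXsubCexp lam m) -> monogenic z (prodXsubCexp lam' m') ->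
  exists2 s : 'I_r -> 'I_r, injective s & forall i, m i = m' (s i).
Proof.
move=> injphi injl m0 dimE [_ kery] [surz kerz].
have [h hE] := surz (phi y).
pose F := prodXsubCexp (fun i => h.[lam' i]) m'.
(* The image of this element is the product of the (h(z) - h(b_j))^(m_j), and X - b_j divides h -
   h(b_j), so the polynomial that kills [z] divides the corresponding product. *)
have : horner_alg y F = 0.
  apply: injphi; rewrite rmorph0.
  have -> : phi (horner_alg y F) = horner_alg (phi y) F.
    elim/poly_ind: F => [|p c IH]; first by rewrite !rmorph0.
    by rewrite !rmorphD !rmorphM /= !horner_algX !horner_algC linearZ /=
      rmorph1 IH.
  rewrite hE.
  have -> : horner_alg (horner_alg z h) F =
      horner_alg z (\prod_i (h - (h.[lam' i])%:P) ^+ m' i).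
    rewrite /F /prodXsubCexp !rmorph_prod; apply: eq_bigr => i _.
    by rewrite !rmorphXn !rmorphB /= !horner_algX !horner_algC.
  apply/kerz; rewrite /prodXsubCexp.
  elim/big_rec2: _ => [|i p q _ IH]; first exact: dvdpp.
  rewrite dvdp_mul // dvdp_exp2r // dvdp_XsubCl.
  by rewrite /root !hornerE subrr.
move/kery => dvd.
have E : prodXsubCexp lam m = F.
  apply/eqP; rewrite -eqp_monic ?prodXsubCexp_monic //.
  rewrite /eqp dvd /=; have := dvdp_size_eqp dvd.
  by rewrite !size_prodXsubCexp dimE eqxx => /esym/andP [].
exact: prodXsubCexp_inj E.
Qed.

End Quotients.

Lemma distinct_rootsP (K : closedFieldType) (f : {poly K}) (r : nat) : f != 0 ->
  has_distinct_roots f r -> exists (lam : 'I_r -> K) (m : 'I_r -> nat),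
    [/\ injective lam, forall i, (0 < m i)%N
      & f = lead_coef f *: prodXsubCexp lam m].
Proof.
move=> f0 [s [Us <- rs]].
pose lam (i : 'I_(size s)) := s`_i.
have injl : injective lam.
  by move=> i j /eqP; rewrite nth_uniq // => /eqP /val_inj.
have rl i : root f (lam i) by rewrite rs mem_nth.
exists lam, (fun i => mup (lam i) f); split => //.
  by move=> i; rewrite -XsubC_dvd // dvdp_XsubCl.
have /dvdpP [q qE] : prodXsubCexp lam (fun i => mup (lam i) f) %| f.
  by apply: prodXsubCexp_dvd => // i; rewrite -mup_geq.
have q0 : q != 0 by apply: contraNneq f0 => q0; rewrite qE q0 mul0r.
(* A root of the cofactor would be some [lam i] and would raise its multiplicity in [f]; over a
   closed field the cofactor is therefore constant. *)
case: (eqVneq (size q) 1%N) => [sq|/closed_rootP [c qc]].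
  have /size_poly1P [c c0 qc] : size q == 1%N by rewrite sq.
  rewrite {1}qE qc mul_polyC; congr (_ *: _).
  by rewrite qE qc mul_polyC lead_coefZ (monicP (prodXsubCexp_monic _ _)) mulr1.
have : root f c by rewrite qE rootM qc.
rewrite rs => /(nthP 0) [k ks kc]; pose i := Ordinal ks.
have ci : c = lam i by rewrite -kc.
have [p pE _] := prodXsubCexpD1 (fun i => mup (lam i) f) i injl.
have : ('X - (lam i)%:P) ^+ (mup (lam i) f).+1 %| f.
  rewrite [in X in _ %| X]qE pE mulrCA exprSr dvdp_mul //.
  by rewrite dvdp_mulr // dvdp_XsubCl -ci.
by rewrite -mup_geq // ltnn.
Qed.

Lemma distinct_roots_prodXsubCexp (K : fieldType) (r : nat) (lam : 'I_r -> K)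
    (m : 'I_r -> nat) : injective lam -> (forall i, 0 < m i)%N ->
  has_distinct_roots (prodXsubCexp lam m) r.
Proof.
move=> injl m0; exists (codom lam); split.
- exact/injectiveP.
- by rewrite size_codom card_ord.
move=> c; apply/idP/idP.
  rewrite /root horner_prod => /prodf_eq0 [i _].
  rewrite !hornerE expf_eq0 subr_eq0 => /andP [_ /eqP ->].
  exact: codom_f.
case/codomP => i ->; have [q -> _] := prodXsubCexpD1 m i injl.
by rewrite rootM; apply/orP; left; rewrite /root !hornerE subrr expr0n;
  case: (m i) (m0 i).
Qed.

(** * Polynomial functions *)

Lemma linear_lfun (K : fieldType) (V W : vectType K) (f : V -> W) :
  linear f -> exists l : 'Hom(V, W), forall v, l v = f v.
Proof.
move=> fL; pose f1 := GRing.isSemilinear.Build K V W _ f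
  (GRing.semilinear_linear fL).
pose g : {linear V -> W} := HB.pack f f1.
by exists (linfun g) => v; rewrite lfunE.
Qed.

Section FunctionRing.
Variables (K : fieldType) (X : Type).

(** Polynomial, regular, fractional and one-variable polynomial functions all form such a ring, so
    closure under determinants and substitutions is proved once. The first clause stands in for
    functional extensionality. *)
Definition function_ring (R : (X -> K) -> Prop) : Prop :=
  [/\ forall f g, f =1 g -> R f -> R g,
      forall c, R (fun=> c),
      forall f g, R f -> R g -> R (fun x => f x + g x)
    & forall f g, R f -> R g -> R (fun x => f x * g x)].

Variables (R : (X -> K) -> Prop) (RR : function_ring R).

Lemma function_ring_sum I (r : seq I) (P : pred I) (F : I -> X -> K) :
  (forall i, R (F i)) -> R (fun x => \sum_(i <- r | P i) F i x).
Proof.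
case: RR => ext cst add _ HF; elim: r => [|i r IH].
  by apply: (ext (fun=> 0)) => // x; rewrite big_nil.
case Pi: (P i); last by apply: ext IH => x; rewrite big_cons Pi.
by apply: ext (add _ _ (HF i) IH) => x; rewrite big_cons Pi.
Qed.

Lemma function_ring_prod I (r : seq I) (P : pred I) (F : I -> X -> K) :
  (forall i, R (F i)) -> R (fun x => \prod_(i <- r | P i) F i x).
Proof.
case: RR => ext cst _ mul HF; elim: r => [|i r IH].
  by apply: (ext (fun=> 1)) => // x; rewrite big_nil.
case Pi: (P i); last by apply: ext IH => x; rewrite big_cons Pi.
by apply: ext (mul _ _ (HF i) IH) => x; rewrite big_cons Pi.
Qed.

Lemma function_ring_exp f n : R f -> R (fun x => f x ^+ n).
Proof.
case: RR => ext cst _ mul Hf; elim: n => [|n IH].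
  by apply: (ext (fun=> 1)).
by apply: ext (mul _ _ Hf IH) => x; rewrite exprS.
Qed.

Lemma function_ring_scale c f : R f -> R (fun x => c * f x).
Proof. by case: RR => _ cst _ mul; apply: mul. Qed.

Lemma function_ring_meval n (p : {mpoly K[n]}) (F : 'I_n -> X -> K) :
  (forall i, R (F i)) -> R (fun x => p.@[fun i => F i x]).
Proof.
move=> HF; case: (RR) => ext _ _ _.
apply: (ext (fun x => \sum_(m <- msupp p) p@_m * \prod_i F i x ^+ m i)).
  by move=> x; rewrite mevalE.
apply: function_ring_sum => m; apply: function_ring_scale.
by apply: function_ring_prod => i; apply: function_ring_exp.
Qed.

Lemma function_ring_mx m l (F : X -> 'M[K]_(m, l)) (g : 'M[K]_(m, l) -> K) :
  (forall k u v, g (k *: u + v) = k * g u + g v) ->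
  (forall i j, R (fun x => F x i j)) -> R (fun x => g (F x)).
Proof.
move=> gL HF; case: (RR) => ext _ _ _.
have g0 : g 0 = 0 by have := gL (-1) 0 0; rewrite scaler0 addr0 mulN1r addNr.
have gD u v : g (u + v) = g u + g v.
  by have := gL 1 u v; rewrite scale1r mul1r.
have gZ k u : g (k *: u) = k * g u by have := gL k u 0; rewrite !addr0 g0 addr0.
apply: (ext (fun x => \sum_i \sum_j g (delta_mx i j) * F x i j)).
  move=> x; rewrite [in RHS](matrix_sum_delta (F x)).
  rewrite (big_morph g gD g0); apply: eq_bigr => i _.
  by rewrite (big_morph g gD g0); apply: eq_bigr => j _; rewrite gZ mulrC.
apply: function_ring_sum => i; apply: function_ring_sum => j.
exact: function_ring_scale.
Qed.

Lemma function_ring_mx_meval m (F : X -> 'M[K]_m)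
    (p : {mpoly K[\dim {: 'M[K]_m}]}) :
  (forall i j, R (fun x => F x i j)) -> R (fun x => p.@[coords (F x)]).
Proof.
move=> HF; apply: (function_ring_meval p (F := fun i x => coords (F x) i)) => i.
apply: (function_ring_mx (g := fun u => coords u i)) => // k u v.
by rewrite /coords linearP.
Qed.

Lemma function_ring_det m (F : X -> 'M[K]_m) :
  (forall i j, R (fun x => F x i j)) -> R (fun x => \det (F x)).
Proof.
move=> HF; apply: function_ring_sum => s; apply: function_ring_scale.
exact: function_ring_prod.
Qed.

End FunctionRing.

Section PolynomialFunctions.
Variable K : fieldType.

Definition polynomial_function (V : vectType K) (f : V -> K) : Prop :=
  exists p : {mpoly K[\dim {:V}]}, forall v, f v = p.@[coords v].

Lemma polynomial_function_ring (V : vectType K) :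
  function_ring (@polynomial_function V).
Proof.
split.
- by move=> f g fg [p pE]; exists p => v; rewrite -fg.
- by move=> c; exists c%:MP => v; rewrite mevalC.
- by move=> f g [p pE] [q qE]; exists (p + q) => v; rewrite mevalD pE qE.
- by move=> f g [p pE] [q qE]; exists (p * q) => v; rewrite mevalM pE qE.
Qed.

Lemma coords_polynomial (V : vectType K) i :
  polynomial_function (fun v : V => coords v i).
Proof. by exists 'X_i => v; rewrite mevalXU. Qed.

Lemma linear_polynomial (V : vectType K) (f : V -> K) :
  (forall k u v, f (k *: u + v) = k * f u + f v) -> polynomial_function f.
Proof.
move=> fL.
have f0 : f 0 = 0 by have := fL (-1) 0 0; rewrite scaler0 addr0 mulN1r addNr.
have fD u v : f (u + v) = f u + f v by have := fL 1 u v; rewrite scale1r mul1r.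
have fZ k u : f (k *: u) = k * f u by have := fL k u 0; rewrite !addr0 f0 addr0.
have [ext _ _ _] := polynomial_function_ring V.
apply: (ext (fun v => \sum_(i < \dim {:V}) f ((vbasis {:V})`_i) * coords v i)).
  move=> v; rewrite [in RHS](coord_vbasis (memvf v)) (big_morph f fD f0).
  by apply: eq_bigr => i _; rewrite fZ mulrC.
apply: function_ring_sum (polynomial_function_ring V) _ _ _ _ _ => i.
apply: function_ring_scale; first exact: polynomial_function_ring.
exact: coords_polynomial.
Qed.

Lemma coords_sum (V : vectType K) (c : 'I_(\dim {:V}) -> K) :
  coords (\sum_i c i *: (vbasis {:V})`_i) =1 c.
Proof.
by move=> i; rewrite /coords coord_sum_free // (basis_free (vbasisP _)).
Qed.

Variable charK0 : [pchar K]%R =i pred0.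

(** Uniqueness of digits in base [B], which keeps distinct monomials distinct in Kronecker's
    substitution. *)
Lemma base_expansion_inj B n (f g : nat -> nat) :
  (forall i, f i < B)%N -> (forall i, g i < B)%N ->
  (\sum_(i < n) f i * B ^ i = \sum_(i < n) g i * B ^ i)%N ->
  forall i, (i < n)%N -> f i = g i.
Proof.
elim: n f g => [|n IH] f g fB gB //.
have B0 : (0 < B)%N by apply: leq_ltn_trans (fB 0%N).
have E (h : nat -> nat) : (\sum_(i < n.+1) h i * B ^ i =
    (\sum_(i < n) h i.+1 * B ^ i) * B + h 0)%N.
  rewrite big_ord_recl expn0 muln1 addnC big_distrl /=; congr (_ + _)%N.
  by apply: eq_bigr => i _; rewrite /bump /= add1n expnSr mulnA.
rewrite !E => H [_|i].
  by move/(congr1 (modn^~ B)): H; rewrite !modnMDl !modn_small.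
rewrite ltnS; apply: (IH (fun i => f i.+1) (fun i => g i.+1)) => // {i}.
by move/(congr1 (divn^~ B)): H; rewrite !divnMDl // !divn_small // !addn0.
Qed.

(* Kronecker's substitution of x ^ (B ^ i) for the i-th variable. *)
Lemma meval_eq0 n (p : {mpoly K[n]}) : (forall v, p.@[v] = 0) -> p = 0.
Proof.
(* The size of [p] exceeds every exponent that occurs in it, so exponents are digits in base [B]. *)
move=> p0; pose B := msize p.
pose kr (m : 'X_{1..n}) := (\sum_(i < n) m i * B ^ i)%N.
pose q : {poly K} := \sum_(m <- msupp p) p@_m *: 'X^(kr m).
have q0 : q = 0.
  apply: (poly_nat_eq charK0) => k; rewrite horner0.
  rewrite -(p0 (fun i : 'I_n => k%:R ^+ (B ^ i)%N)) mevalE horner_sum.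
  apply: eq_bigr => m _; rewrite hornerZ hornerXn; congr (_ * _).
  rewrite -prodrXr; apply: eq_bigr => i _.
  by rewrite -exprM mulnC.
apply/mpolyP => m; rewrite mcoeff0; apply/eqP; rewrite mcoeff_eq0;
  apply/negP => mp.
have mB (m' : 'X_{1..n}) : m' \in msupp p -> forall i : 'I_n, (m' i < B)%N.
  move=> /msize_mdeg_lt m'p i; apply: leq_ltn_trans m'p.
  by rewrite mdegE (bigD1 i) //= leq_addr.
have := congr1 (fun q : {poly K} => q`_(kr m)) q0; rewrite coef0 coef_sum.
rewrite (bigD1_seq m) ?msupp_uniq //= coefZ coefXn eqxx mulr1.
rewrite big_seq_cond big1 ?addr0 => [/eqP|m' /andP [m'p m'm]].
  by rewrite mcoeff_eq0 mp.
rewrite coefZ coefXn; case: eqP => [km|_]; last by rewrite mulr0.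
case/eqP: m'm; apply/mnmP => i.
pose ext (m1 : 'X_{1..n}) (k : nat) := if insub k is Some j then m1 (j :
  'I_n) else 0%N.
have B0 : (0 < B)%N by apply: leq_ltn_trans (mB m mp i).
have extB m1 : m1 \in msupp p -> forall k, (ext m1 k < B)%N.
  by move=> m1p k; rewrite /ext; case: insubP => // j _ _; apply: mB.
have extE m1 (j : 'I_n) : ext m1 j = m1 j by rewrite /ext valK.
have krE m1 : kr m1 = (\sum_(i < n) ext m1 i * B ^ i)%N.
  by apply: eq_bigr => j _; rewrite extE.
rewrite !krE in km; rewrite -!extE; apply/esym.
exact: base_expansion_inj (extB m mp) (extB m' m'p) km i (ltn_ord i).
Qed.

End PolynomialFunctions.

(** * Density of nonempty open sets *)

Section Density.
Variables (K : fieldType) (charK0 : [pchar K]%R =i pred0) (V : vectType K).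

Lemma polynomial_eq0 (p : {mpoly K[\dim {:V}]}) :
  (forall v : V, p.@[coords v] = 0) -> p = 0.
Proof.
move=> p0; apply: (meval_eq0 charK0) => c.
by rewrite -(p0 (\sum_i c i *: (vbasis {:V})`_i)); apply: meval_eq => i;
  rewrite coords_sum.
Qed.

Lemma nonempty_open_principal (O : V -> Prop) v0 : zariski_open O -> O v0 ->
  exists2 p : {mpoly K[\dim {:V}]}, p != 0 &
    forall v, p.@[coords v] != 0 -> O v.
Proof.
case=> I IO Ov0.
have [p Ip pv0] : exists2 p, I p & p.@[coords v0] != 0.
  apply: NNPP => no; apply: (IO v0).2 => // p Ip; apply/eqP.
  by apply: contraT => pv0; case: no; exists p.
exists p; first by apply: contraNneq pv0 => ->; rewrite meval0.
move=> v pv; apply: NNPP => /IO /(_ p Ip) pv0'.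
by rewrite pv0' eqxx in pv.
Qed.

Lemma open_dense (O : V -> Prop) v0 (p : {mpoly K[\dim {:V}]}) :
  zariski_open O -> O v0 -> (forall v, O v -> p.@[coords v] = 0) -> p = 0.
Proof.
move=> oO Ov0 p0; have [q q0 qO] := nonempty_open_principal oO Ov0.
have /eqP : p * q = 0.
  apply: polynomial_eq0 => v; rewrite mevalM.
  by case: (eqVneq q.@[coords v] 0) => [->|/qO /p0 ->]; rewrite ?mulr0 ?mul0r.
by rewrite mulf_eq0 (negPf q0) orbF => /eqP.
Qed.

Lemma open_inter (O O' : V -> Prop) v0 v0' : zariski_open O -> O v0 ->
  zariski_open O' -> O' v0' -> exists2 v, O v & O' v.
Proof.
move=> oO Ov0 oO' Ov0'.
have [q q0 qO] := nonempty_open_principal oO Ov0.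
have [q' q0' qO'] := nonempty_open_principal oO' Ov0'.
apply: NNPP => no; have /eqP : q * q' = 0.
  apply: polynomial_eq0 => v; rewrite mevalM; apply/eqP.
  apply: contraT; rewrite mulf_eq0 negb_or => /andP [/qO Ov /qO' Ov'].
  by case: no; exists v.
by rewrite mulf_eq0 (negPf q0) (negPf q0').
Qed.

End Density.

(** * Regular functions and dimension *)

Section Regular.
Variables (K : fieldType) (m : nat) (G : 'M[K]_m -> Prop).
Hypothesis G_unit : forall g, G g -> g \in unitmx.

Let det_neq0 g : G g -> \det g != 0.
Proof. by move/G_unit; rewrite unitmxE unitfE. Qed.

Lemma polynomial_function_entry i j :
  polynomial_function (fun g : 'M[K]_m => g i j).
Proof. by apply: linear_polynomial => k u v; rewrite !mxE. Qed.

Lemma polynomial_function_det : polynomial_function (fun g : 'M[K]_m => \det g).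
Proof.
apply: (function_ring_det (polynomial_function_ring _) (F := id)) => i j.
exact: polynomial_function_entry.
Qed.

Lemma polynomial_regular f : polynomial_function f -> regular_on G f.
Proof. by case=> p pE; exists p, 0%N => g _; rewrite expr0 divr1. Qed.

Lemma regular_on_ring : function_ring (regular_on G).
Proof.
have [d dE] := polynomial_function_det; split.
- by move=> f g fg [p [k pE]]; exists p, k => h Gh; rewrite -fg pE.
- by move=> c; apply: polynomial_regular; exists c%:MP => v; rewrite mevalC.
- move=> f g [p [k pE]] [q [l qE]]; exists (p * d ^+ l + q * d ^+ k),
  (k + l)%N => h Gh.
  rewrite mevalD !mevalM !rmorphXn /= -!dE pE // qE // exprD.
  by field; rewrite !expf_neq0 // det_neq0.
- move=> f g [p [k pE]] [q [l qE]]; exists (p * q), (k + l)%N => h Gh.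
  by rewrite mevalM pE // qE // exprD; field; rewrite !expf_neq0 // det_neq0.
Qed.

End Regular.

(** * Coordinates on (G_m)^r x (G_a)^s *)

Section TorusVectorGroup.
Variables (K : fieldType) (r s : nat).
Implicit Types v w : 'I_(r + s) -> K.

(** Points are coded as functions on ['I_(r + s)], so that they can be substituted in [{mpoly
    K[r + s]}]. *)
Definition tv_matrix v : 'M[K]_(r + (1 + s)) :=
  block_mx (diag_mx (\row_i v (lshift s i))) 0 0
    (block_mx 1%:M (\row_j v (rshift r j)) 0 1%:M).

Definition tv_coord (M : 'M[K]_(r + (1 + s))) (i : 'I_(r + s)) : K :=
  match split i with
  | inl k => M (lshift _ k) (lshift _ k)
  | inr j => M (rshift r (lshift s 0)) (rshift r (rshift 1 j))
  end.

Definition tv_mul v w : 'I_(r + s) -> K :=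
  fun i => if split i is inl _ then v i * w i else v i + w i.

Definition torus_nonzero v := forall i : 'I_r, v (lshift s i) != 0.

Lemma tv_matrixK v : tv_coord (tv_matrix v) =1 v.
Proof.
move=> i; rewrite /tv_coord /tv_matrix.
case: (split_ordP i) => k ->; rewrite ?(unsplitK (inl k)) ?(unsplitK (inr k)).
  by rewrite block_mxEul !mxE eqxx mulr1n.
by rewrite block_mxEdr block_mxEur mxE.
Qed.

Lemma eq_tv_matrix v w : v =1 w -> tv_matrix v = tv_matrix w.
Proof.
move=> vw; rewrite /tv_matrix; congr block_mx; [congr diag_mx|congr block_mx];
  by apply/rowP => i; rewrite !mxE vw.
Qed.

Lemma tv_matrixM v w : tv_matrix v *m tv_matrix w = tv_matrix (tv_mul v w).
Proof.
rewrite /tv_matrix mulmx_block !mulmx0 !mul0mx !addr0 !add0r.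
rewrite mulmx_block !mulmx0 !mul0mx !mul1mx !mulmx1 !addr0 !add0r mulmx_diag.
congr block_mx; [congr diag_mx|congr block_mx]; apply/rowP => i;
  rewrite !mxE /tv_mul.
  by rewrite (unsplitK (inl i)).
by rewrite (unsplitK (inr i)) addrC.
Qed.

Lemma torus_vector_groupP M : torus_vector_group M <->
  exists2 v, torus_nonzero v & M = tv_matrix v.
Proof.
split=> [[t [a [t0 ->]]]|[v v0 ->]]; last first.
  by exists (\row_i v (lshift s i)), (\row_j v (rshift r j)); split => // i;
    rewrite mxE.
exists (fun i => match split i with inl k => t 0 k | inr j => a 0 j end).
  by move=> i; rewrite (unsplitK (inl i)).
rewrite /tv_matrix; congr block_mx; [congr diag_mx|congr block_mx];
  apply/rowP => i; rewrite !mxE.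
  by rewrite (unsplitK (inl i)).
by rewrite (unsplitK (inr i)).
Qed.

Lemma function_ring_tv_matrix X (R : (X -> K) -> Prop) (v :
  X -> 'I_(r + s) -> K) :
  function_ring R -> (forall i, R (fun x => v x i)) ->
  forall i j, R (fun x => tv_matrix (v x) i j).
Proof.
move=> RR vR i j; have [ext cst _ mul] := RR.
have mR b f : R f -> R (fun x => f x *+ (b : bool)).
  case: b => Rf; first by apply: ext Rf => x; rewrite mulr1n.
  by apply: ext (cst 0) => x; rewrite mulr0n.
rewrite /tv_matrix; case: (split_ordP i) => k ->; case: (split_ordP j) => l ->.
- apply: ext (mR (k == l) _ (vR (lshift s l))) => x.
  by rewrite block_mxEul !mxE; case: eqP => [->|].
- by apply: ext (cst 0) => x; rewrite block_mxEur mxE.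
- by apply: ext (cst 0) => x; rewrite block_mxEdl mxE.
case: (split_ordP k) => k' ->; case: (split_ordP l) => l' ->.
- by apply: ext (cst (k' == l')%:R) => x; rewrite block_mxEdr block_mxEul !mxE.
- by apply: ext (vR (rshift r l')) => x; rewrite block_mxEdr block_mxEur mxE.
- by apply: ext (cst 0) => x; rewrite block_mxEdr block_mxEdl mxE.
- by apply: ext (cst (k' == l')%:R) => x; rewrite block_mxEdr block_mxEdr !mxE.
Qed.

Lemma det_tv_matrix v : \det (tv_matrix v) = \prod_i v (lshift s i).
Proof.
rewrite /tv_matrix det_ublock det_ublock !det1 !mulr1 det_diag.
by apply: eq_bigr => i _; rewrite mxE.
Qed.

(** Any denominator without zeros on the parameter space is allowed, so the shape of the determinant
    of a parametrized group element need not be known. *)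
Definition fraction_function (f : ('I_(r + s) -> K) -> K) : Prop :=
  exists P Q : {mpoly K[r + s]}, forall v, torus_nonzero v ->
    Q.@[v] != 0 /\ f v = P.@[v] / Q.@[v].

Lemma fraction_function_ring : function_ring fraction_function.
Proof.
split.
- move=> f g fg [P [Q H]]; exists P, Q => v /H [Q0 fE]; by rewrite -fg.
- by move=> c; exists c%:MP, 1 => v _; rewrite mevalC meval1 oner_neq0 divr1.
- move=> f g [P [Q H]] [P' [Q' H']]; exists (P * Q' + P' * Q), (Q * Q') => v v0.
  have [Q0 ->] := H v v0; have [Q0' ->] := H' v v0.
  rewrite mevalD !mevalM mulf_neq0 //; split => //; by field; rewrite Q0 Q0'.
- move=> f g [P [Q H]] [P' [Q' H']]; exists (P * P'), (Q * Q') => v v0.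
  have [Q0 ->] := H v v0; have [Q0' ->] := H' v v0.
  rewrite !mevalM mulf_neq0 //; split => //; by field; rewrite Q0 Q0'.
Qed.

Lemma fraction_function_div f g : fraction_function f -> fraction_function g ->
  (forall v, torus_nonzero v -> g v != 0) ->
  fraction_function (fun v => f v / g v).
Proof.
move=> [P [Q H]] [P' [Q' H']] g0; exists (P * Q'), (Q * P') => v v0.
have [Q0 ->] := H v v0; have [Q0' gE] := H' v v0; have := g0 v v0.
rewrite gE mulf_eq0 invr_eq0 (negPf Q0') orbF => P0'.
by rewrite !mevalM mulf_neq0 //; split => //; field; rewrite Q0 Q0' P0'.
Qed.

Lemma fraction_function_var i : fraction_function (fun v => v i).
Proof. by exists 'X_i, 1 => v _; rewrite mevalXU meval1 oner_neq0 divr1. Qed.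

End TorusVectorGroup.

(** * Linear dependence by counting monomials *)

Section Counting.
Variable K : fieldType.

Lemma ffun_mnm_inj (a b : nat) : injective
  (fun e : {ffun 'I_a -> 'I_b} => [multinom (e i : nat) | i < a]).
Proof.
move=> e e' /mnmP E; apply/ffunP => i; apply/val_inj.
by have := E i; rewrite !mnmE.
Qed.

(* There are at most W ^ N monomials of degree < W in N variables. *)
Lemma polynomials_linearly_dependent N W (I : finType) (R : I -> {mpoly K[N]}) :
  (forall i, msize (R i) <= W)%N -> (W ^ N < #|I|)%N ->
  exists2 u : I -> K, exists i, u i != 0 & \sum_i u i *: R i = 0.
Proof.
move=> RW ltI; pose J : finType := {ffun 'I_N -> 'I_W}.
pose mn (e : J) := [multinom (e i : nat) | i < N].
pose A : 'M[K]_(#|I|, #|J|) :=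
  \matrix_(i, j) (R (enum_val i))@_(mn (enum_val j)).
have : kermx A != 0.
  rewrite -mxrank_eq0 mxrank_ker subn_eq0 -ltnNge.
  apply: leq_ltn_trans (rank_leq_col A) _.
  by rewrite card_ffun !card_ord.
case/rowV0Pn => u /sub_kermxP uA u0.
have [i ui] : exists i, u 0 i != 0.
  apply/existsP; apply: contraNT u0; rewrite negb_exists => /forallP H.
  by apply/eqP/rowP => i; rewrite mxE; apply/eqP; rewrite -[_ == _]negbK H.
exists (fun i => u 0 (enum_rank i)); first by exists (enum_val i);
  rewrite enum_valK.
apply/mpolyP => k; rewrite mcoeff0 raddf_sum /=.
case: (boolP [forall i, (k i < W)%N]) => [/forallP kW|].
  pose e : J := [ffun i => Ordinal (kW i)].
  have kE : k = mn e by apply/mnmP => j; rewrite mnmE ffunE.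
  have := congr1 (fun M : 'M__ => M 0 (enum_rank e)) uA; rewrite !mxE => H.
  rewrite -[RHS]H (reindex (@enum_val I I)) /=; last first.
    by exists enum_rank => j _; rewrite ?enum_valK ?enum_rankK.
  apply: eq_bigr => j _; rewrite mcoeffZ enum_valK mxE enum_rankK.
  by rewrite -kE.
rewrite negb_forall => /existsP [j]; rewrite -leqNgt => Wk.
apply: big1 => i' _; rewrite mcoeffZ.
have := @msize_mdeg_ge _ _ (R i') k; rewrite -mcoeff_eq0 => /(_ _)/eqP ->;
  rewrite ?mulr0 //.
apply: leq_trans (RW i') (leq_trans Wk _).
by rewrite mdegE (bigD1 j) //= leq_addr.
Qed.

Lemma msize_mul_leq N (p q : {mpoly K[N]}) a b :
  (msize p <= a.+1)%N -> (msize q <= b.+1)%N -> (msize (p * q) <= (a + b).+1)%N.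
Proof.
case: (eqVneq p 0) => [->|p0]; first by rewrite mul0r msize0.
case: (eqVneq q 0) => [->|q0]; first by rewrite mulr0 msize0.
move=> pa qb; rewrite msizeM //; have := leq_add pa qb; rewrite addnS addSn.
by case: (_ + _)%N.
Qed.

Lemma msize_exp_le N (p : {mpoly K[N]}) C k :
  (msize p <= C.+1)%N -> (msize (p ^+ k) <= (k * C).+1)%N.
Proof.
move=> pC; elim: k => [|k IH]; first by rewrite expr0 msize1.
by rewrite exprS mulSn msize_mul_leq.
Qed.

End Counting.

Section Dimension.
Variables (K : fieldType) (charK0 : [pchar K]%R =i pred0).
Variables (m : nat) (G : 'M[K]_m -> Prop) (G_alg : linear_algebraic_group G).
Variables (r s : nat) (phi : 'M[K]_m -> 'M[K]_(r + (1 + s))).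
Variable psi : 'M[K]_(r + (1 + s)) -> 'M[K]_m.
Let T := @torus_vector_group K r s.
Hypothesis phi_morph : group_morphism G T phi.
Hypothesis psi_morph : group_morphism T G psi.
Hypothesis phiK : forall g, G g -> psi (phi g) = g.
Hypothesis psiK : forall h, T h -> phi (psi h) = h.

Definition tv_param (v : 'I_(r + s) -> K) : 'M[K]_m := psi (tv_matrix v).

Lemma tv_param_in v : torus_nonzero v -> G (tv_param v).
Proof.
by move=> v0; case: psi_morph => + _ _; apply; apply/torus_vector_groupP;
  exists v.
Qed.

Lemma tv_param_surj g : G g -> exists2 v, torus_nonzero v & g = tv_param v.
Proof.
move=> Gg; have [phiT _ _] := phi_morph.
have /torus_vector_groupP [v v0 vE] := phiT g Gg.
by exists v; rewrite // /tv_param -vE phiK.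
Qed.

Lemma phi_tv_param v : torus_nonzero v -> phi (tv_param v) = tv_matrix v.
Proof. by move=> v0; apply: psiK; apply/torus_vector_groupP; exists v. Qed.

Lemma tv_paramM v w : torus_nonzero v -> torus_nonzero w ->
  tv_param v *m tv_param w = tv_param (tv_mul v w).
Proof.
move=> v0 w0; case: psi_morph => _ psiM _;
  rewrite /tv_param -tv_matrixM psiM //;
  apply/torus_vector_groupP; [by exists v|by exists w].
Qed.

Lemma regular_tv_param f : regular_on G f ->
  fraction_function (fun v => f (tv_param v)).
Proof.
case=> p [k pE]; have FR := @fraction_function_ring K r s.
have [ext _ _ _] := FR; case: psi_morph => _ _ psi_reg.
have entry i j : fraction_function (fun v => tv_param v i j).
  have [q [l qE]] := psi_reg i j.
  have tvR := function_ring_tv_matrix FR (@fraction_function_var K r s).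
  have [P [Q H]] : fraction_function (fun v : 'I_(r + s) -> K =>
      q.@[coords (tv_matrix v)] / \det (tv_matrix v) ^+ l).
    apply: fraction_function_div.
    - exact: function_ring_mx_meval FR _ _ _ tvR.
    - apply: function_ring_exp => //; exact: function_ring_det FR _ _ tvR.
    - move=> v v0; rewrite expf_neq0 // det_tv_matrix.
      by apply/prodf_neq0 => i' _.
  exists P, Q => v v0; have [Q0 <-] := H v v0; split => //.
  by apply: qE; apply/torus_vector_groupP; exists v.
have [P [Q H]] : fraction_function (fun v =>
    p.@[coords (tv_param v)] / \det (tv_param v) ^+ k).
  apply: fraction_function_div.
  - exact: function_ring_mx_meval FR _ _ _ entry.
  - apply: function_ring_exp => //; exact: function_ring_det FR _ _ entry.
  - move=> v v0; rewrite expf_neq0 // -unitfE -unitmxE; apply: (lag_unit G_alg).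
    exact: tv_param_in.
exists P, Q => v v0; have [Q0 <-] := H v v0; split => //.
by apply: pE; apply: tv_param_in.
Qed.

(** The coordinates of [phi] are algebraically independent: a relation holds wherever the torus
    coordinates are nonzero, so its product with them vanishes everywhere. *)
Lemma has_dimension_geq n : has_dimension G n -> (r + s <= n)%N.
Proof.
case=> _ /(_ (r + s)%N (fun i g => tv_coord (phi g) i)); apply.
  move=> i; case: phi_morph => _ _ reg; rewrite /tv_coord.
  by case: (split i) => k; apply: reg.
move=> p p0; pose q := \prod_(i < r) ('X_(lshift s i) : {mpoly K[r + s]}).
have q0 : q != 0.
  apply/prodf_neq0 => i _; apply/eqP => /(congr1 (meval (fun=> 1))).
  by rewrite mevalXU meval0 => /eqP; rewrite oner_eq0.
have /eqP : p * q = 0.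
  apply: (meval_eq0 charK0) => v; rewrite mevalM.
  case: (eqVneq q.@[v] 0) => [->|qv]; first by rewrite mulr0.
  have v0 : torus_nonzero v.
    move=> i; apply: contraNneq qv => vi;
      rewrite /q rmorph_prod /= (bigD1 i) //=.
    by rewrite mevalXU vi mul0r.
  have := p0 (tv_param v) (tv_param_in v0); rewrite phi_tv_param //.
  by rewrite (meval_eq (v2 := v)) => [->|i]; rewrite ?mul0r ?tv_matrixK.
by rewrite mulf_eq0 (negPf q0) orbF => /eqP.
Qed.

(** More than r + s functions on the parameter space are dependent: their monomials with exponents
    below [B] outnumber the dimension of the space of numerators once [B] is large. *)
Lemma has_dimension_leq n : has_dimension G n -> (n <= r + s)%N.
Proof.
case=> [[f f_reg f_ind] _]; rewrite leqNgt; apply/negP;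
  set N := (r + s)%N => Nn.
have H i := regular_tv_param (f_reg i).
pose P0 i := sval (constructive_indefinite_description _ (H i)).
have H' i : exists Q : {mpoly K[N]}, forall v, torus_nonzero v ->
    Q.@[v] != 0 /\ f i (tv_param v) = (P0 i).@[v] / Q.@[v].
  by rewrite /P0; case: constructive_indefinite_description.
pose Q0 i := sval (constructive_indefinite_description _ (H' i)).
have HQ i v : torus_nonzero v ->
    (Q0 i).@[v] != 0 /\ f i (tv_param v) = (P0 i).@[v] / (Q0 i).@[v].
  by move: v; rewrite /Q0; case: constructive_indefinite_description.
pose Q := \prod_i Q0 i; pose P i := P0 i * \prod_(j | j != i) Q0 j.
have Qv v : torus_nonzero v -> Q.@[v] != 0.
  move=> v0; rewrite /Q rmorph_prod; apply/prodf_neq0 => i _.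
  by have [] := HQ i v v0.
have fE i v : torus_nonzero v -> f i (tv_param v) * Q.@[v] = (P i).@[v].
  move=> v0; have [Qi ->] := HQ i v v0.
  by rewrite /Q /P (bigD1 i) //= !mevalM mulrA divfK.
pose C := maxn (msize Q) (\max_i msize (P i)).
have QC : (msize Q <= C.+1)%N by rewrite ltnW // ltnS leq_maxl.
have PC i : (msize (P i) <= C.+1)%N.
  by rewrite ltnW // ltnS; apply: leq_trans (leq_maxr _ _); apply: leq_bigmax.
(* This choice gives (nBC + 1)^N <= (nC + 1)^N B^N < B^(N+1) <= B^n, the last because N < n. *)
pose B := ((n * C).+1 ^ N).+1; pose I : finType := {ffun 'I_n -> 'I_B}.
(* Padding with powers of [Q] gives all monomials in the functions the same denominator, Q^(nB). *)
pose R (e : I) : {mpoly K[N]} := \prod_i (P i ^+ e i * Q ^+ (B - e i)).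
have Rsize e : (msize (R e) <= (n * (B * C)).+1)%N.
  have fact i : (msize (P i ^+ e i * Q ^+ (B - e i)) <= (B * C).+1)%N.
    have := msize_mul_leq (msize_exp_le (e i) (PC i)) (msize_exp_le (B - e i)
      QC).
    by rewrite -mulnDl subnKC // ltnW.
  have szl l : (msize (\prod_(i <- l) (P i ^+ e i * Q ^+ (B - e i)))
      <= (size l * (B * C)).+1)%N.
    elim: l => [|i l IH]; first by rewrite big_nil msize1.
    by rewrite big_cons mulSn msize_mul_leq.
  have := szl (index_enum 'I_n).
  by rewrite (_ : size _ = n) // -[index_enum _]enumT size_enum_ord.
have ltI : (((n * (B * C)).+1) ^ N < #|I|)%N.
  rewrite card_ffun !card_ord; apply: (@leq_trans (B ^ N.+1)); last first.
    by rewrite leq_exp2l // /B ltnS expn_gt0.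
  rewrite expnS; apply: (@leq_ltn_trans ((n * C).+1 ^ N * B ^ N)).
    rewrite -expnMn; case: (N) => [|N']; first by rewrite !expn0.
    by rewrite leq_exp2r // mulSn -mulnA (mulnC C B) -add1n leq_add2r.
  by rewrite ltn_mul2r expn_gt0 /B ltnSn.
have [u [e0 ue0] uR] := polynomials_linearly_dependent Rsize ltI.
pose mn (e : I) := [multinom (e i : nat) | i < n].
have /f_ind Z0 : forall g, G g ->
    (\sum_(e : I) u e *: 'X_[mn e] : {mpoly K[n]}).@[fun i => f i g] = 0.
  move=> g /tv_param_surj [v v0 ->]; rewrite rmorph_sum /=.
  have : (\prod_(i < n) Q.@[v] ^+ B) != 0 by apply/prodf_neq0 => i _;
    rewrite expf_neq0 // Qv.
  move=> QB; apply: (mulIf QB); rewrite mul0r -[RHS](rmorph0 (meval v)) -uR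
    rmorph_sum /=.
  rewrite mulr_suml; apply: eq_bigr => e _.
  have RE : (R e).@[v] = \prod_i ((P i).@[v] ^+ e i * Q.@[v] ^+ (B - e i)).
    by rewrite rmorph_prod; apply: eq_bigr => i _; rewrite rmorphM !rmorphXn.
  rewrite !mevalZ RE mevalX -mulrA; congr (_ * _); rewrite -big_split /=.
  apply: eq_bigr => i _; rewrite mnmE -fE // exprMn.
  by rewrite -mulrA -exprD subnKC // ltnW.
have := congr1 (mcoeff (mn e0)) Z0; rewrite mcoeff0 raddf_sum (bigD1 e0) //=.
rewrite mcoeffZ mcoeffX eqxx mulr1 big1 ?addr0 => [/eqP|e ee0];
  first by rewrite (negPf ue0).
rewrite mcoeffZ mcoeffX; case: eqP => [/ffun_mnm_inj E|_];
  last by rewrite mulr0.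
by rewrite E eqxx in ee0.
Qed.

End Dimension.

(** * Rank and dimension of the corresponding algebra *)

Section VectorValued.
Variables (K : fieldType) (X : Type) (R : (X -> K) -> Prop).
Hypothesis RR : function_ring R.

(** The coordinate-free form of regularity used in [action_regular]. *)
Definition vector_valued (V : vectType K) (F : X -> V) : Prop :=
  forall l : 'Hom(V, K^o), R (fun x => l (F x)).

Lemma vector_valued_ext (V : vectType K) (F F' : X -> V) :
  F =1 F' -> vector_valued F -> vector_valued F'.
Proof.
by move=> FF' HF l; case: RR => ext _ _ _; apply: ext (HF l) => x; rewrite FF'.
Qed.

Lemma vector_valued_scale (V : vectType K) f (F : X -> V) :
  R f -> vector_valued F -> vector_valued (fun x => f x *: F x).
Proof.
move=> Rf HF l; case: RR => ext _ _ mul; apply: ext (mul _ _ Rf (HF l)) => x.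
by rewrite linearZ.
Qed.

Lemma vector_valued_cst (V : vectType K) (a : V) : vector_valued (fun=> a).
Proof. by move=> l; case: RR => _ cst _ _; apply: cst. Qed.

Lemma vector_valued_sum (V : vectType K) I (r : seq I) (P : pred I)
    (F : I -> X -> V) : (forall i, vector_valued (F i)) ->
  vector_valued (fun x => \sum_(i <- r | P i) F i x).
Proof.
move=> HF l; case: (RR) => ext _ _ _.
apply: ext (function_ring_sum RR r P (fun i => HF i l)) => x.
by rewrite linear_sum.
Qed.

Lemma vector_valued_coord (V : vectType K) (F : X -> V) i :
  vector_valued F -> R (fun x => coords (F x) i).
Proof.
move=> HF; have [|l lE] := @linear_lfun K V K^o (fun v => coords v i).
  by move=> k u v; rewrite /coords linearP.
by case: RR => ext _ _ _; apply: ext (HF l) => x; rewrite lE.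
Qed.

Lemma vector_valued_linear (V W : vectType K) (f : V -> W) (F : X -> V) :
  linear f -> vector_valued F -> vector_valued (fun x => f (F x)).
Proof.
move=> /linear_lfun [g gE] HF l; case: (RR) => ext _ _ _.
by apply: ext (HF (l \o g)%VF) => x; rewrite lfunE /= gE.
Qed.

Lemma coords_expand (V : vectType K) (v : V) :
  v = \sum_i coords v i *: (vbasis {:V})`_i.
Proof. exact: coord_vbasis (memvf v). Qed.

Lemma vector_valued_mul (A : falgType K) (F F' : X -> A) :
  vector_valued F -> vector_valued F' -> vector_valued (fun x => F x * F' x).
Proof.
move=> HF HF'.
apply: (@vector_valued_ext _ (fun x => \sum_i coords (F x) i *:
    ((vbasis {:A})`_i * F' x))).
  move=> x; rewrite [in RHS](coords_expand (F x)) mulr_suml.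
  by apply: eq_bigr => i _; rewrite scalerAl.
apply: vector_valued_sum => i; apply: vector_valued_scale.
  exact: vector_valued_coord.
apply: (vector_valued_linear (f := fun a => (vbasis {:A})`_i * a)) => // k u v.
by rewrite mulrDr scalerAr.
Qed.

Lemma vector_valued_exp (A : falgType K) (F : X -> A) k :
  vector_valued F -> vector_valued (fun x => F x ^+ k).
Proof.
move=> HF; elim: k => [|k IH].
  by apply: (@vector_valued_ext _ (fun=> 1)) => //; apply: vector_valued_cst.
by apply: vector_valued_ext (vector_valued_mul HF IH) => x; rewrite exprS.
Qed.

Lemma vector_valued_nilexp (A : falgType K)
    (mulC : commutative (@GRing.mul A)) M (F : X -> A) :
  vector_valued F -> vector_valued (fun x => nilexp M (F x : comalg mulC) : A).
Proof.
move=> HF; apply: (@vector_valued_sum A _ _ _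
  (fun (k : 'I_M.+2) x => (k`!%:R^-1 : K) *: (F x ^+ k))) => k.
apply: (vector_valued_scale (f := fun=> (k`!%:R^-1 : K)));
  last exact: vector_valued_exp.
by case: RR => _ cst _ _; apply: cst.
Qed.

End VectorValued.

Definition univariate (K : fieldType) (f : K -> K) : Prop :=
  exists p : {poly K}, forall t, f t = p.[t].

Lemma univariate_ring (K : fieldType) : function_ring (@univariate K).
Proof.
split.
- by move=> f g fg [p pE]; exists p => t; rewrite -fg.
- by move=> c; exists c%:P => t; rewrite hornerC.
- by move=> f g [p pE] [q qE]; exists (p + q) => t; rewrite hornerD pE qE.
- by move=> f g [p pE] [q qE]; exists (p * q) => t; rewrite hornerM pE qE.
Qed.

Lemma univariate_neq0 (K : closedFieldType) (p : {poly K}) :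
  (forall t, p.[t] != 0) -> exists c, p = c%:P.
Proof.
move=> p0; case: (eqVneq (size p) 1%N) => [sp|/closed_rootP [t]].
  by exists p`_0; apply: size1_polyC; rewrite sp.
by rewrite /root (negPf (p0 t)).
Qed.

Section Prehomogeneous.
Variables (K : closedFieldType) (charK0 : [pchar K]%R =i pred0).
Variables (m : nat) (G : 'M[K]_m -> Prop) (G_alg : linear_algebraic_group G).

Let G1 : G 1%:M := lag_one G_alg.
Let GM := lag_mul G_alg.
Let GV := lag_inv G_alg.
Let G_unit := lag_unit G_alg.

Lemma action_oneE (N : prehomogeneous_module G) v : action N 1%:M v = v.
Proof. by rewrite action_one lfunE. Qed.

Lemma action_mulE (N : prehomogeneous_module G) g h v : G g -> G h ->
  action N (g *m h) v = action N g (action N h v).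
Proof. by move=> Gg Gh; rewrite action_mul // lfunE. Qed.

Lemma action_invK (N : prehomogeneous_module G) g v : G g ->
  action N g (action N (invmx g) v) = v.
Proof.
by move=> Gg; rewrite -(action_mulE v Gg (GV Gg)) mulmxV ?G_unit // action_oneE.
Qed.

Lemma action_inj (N : prehomogeneous_module G) g h : G g -> G h ->
  action N g = action N h -> g = h.
Proof.
move=> Gg Gh gh; have E : action N (invmx h *m g) = \1%VF.
  apply/lfunP => v; rewrite (action_mulE v (GV Gh) Gg) gh.
  by rewrite -(action_mulE v (GV Gh) Gh) mulVmx ?G_unit // action_one.
have := action_effective (GM (GV Gh) Gg) E.
by move/(congr1 (mulmx h)); rewrite mulmxA mulmxV ?G_unit // mul1mx mulmx1.
Qed.

(** The coordinates of the orbit map are algebraically independent, because a polynomial that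
    vanishes on the open orbit is zero. *)
Lemma dim_prehomogeneous n (N : prehomogeneous_module G) :
  has_dimension G n -> (\dim {:Defs.space N} <= n)%N.
Proof.
case=> _ G_max; have [v0 O_open] := action_open_orbit N.
apply: (G_max _ (fun i g => coords (action N g v0) i)) => [i|p p0].
  apply: (vector_valued_coord (regular_on_ring G_unit)) => l.
  exact: action_regular.
apply: (@open_dense K charK0 _ _ (action N 1%:M v0) p O_open);
  first by exists 1%:M.
by move=> v [g Gg ->]; rewrite -[RHS](p0 g Gg).
Qed.

(** Each group element acts as multiplication by a unit, recovered as its value at 1; effectiveness
    makes this map injective. *)
Lemma corresponding_morphism (N : prehomogeneous_module G) (A : falgType K) :
  equivalent_images (@module_image K m G N) (@algebra_image K A) ->
  exists alpha : 'M[K]_m -> A,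
    [/\ forall g, G g -> alpha g \is a GRing.unit,
        forall g h, G g -> G h -> alpha (g *m h) = alpha g * alpha h,
        forall g h, G g -> G h -> alpha g = alpha h -> g = h
      & vector_valued (regular_on G) alpha].
Proof.
case=> L bL HH; have [LK KL] := bij_lfunK bL.
pose w := (L^-1)%VF (1 : A).
pose alpha g := L (action N g w).
have H g : G g -> alpha g \is a GRing.unit /\
    forall v, alpha g * L v = L (action N g v).
  move=> Gg; have : algebra_image (L \o action N g \o L^-1)%VF.
    by apply/HH; exists (action N g) => //; exists g.
  case=> a ua /esym/(conj_lfunP _ _ bL) E.
  have aE : a = alpha g by rewrite /alpha -E /w KL amullE mulr1.
  by rewrite -aE; split => // v; rewrite -E amullE.
exists alpha; split.
- by move=> g /H [].
- move=> g h Gg Gh; rewrite {1}/alpha (action_mulE _ Gg Gh).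
  by have [_ <-] := H g Gg.
- move=> g h Gg Gh gh; apply: (@action_inj N g h Gg Gh); apply/lfunP => v.
  apply: (bij_inj bL); have [_ <-] := H g Gg; have [_ <-] := H h Gh.
  by rewrite gh.
apply: (vector_valued_linear (regular_on_ring G_unit)).
  by move=> k u v; rewrite linearP.
by move=> l; apply: action_regular.
Qed.

Lemma corresponding_unit_orbits (N : prehomogeneous_module G) (A : falgType K) :
  equivalent_images (@module_image K m G N) (@algebra_image K A) ->
  finitely_many_orbits N -> finitely_many_unit_orbits A.
Proof.
case=> L bL HH [o Ho]; have [LK KL] := bij_lfunK bL.
exists (map L o) => a; have [w wo [g Gg gw]] := Ho ((L^-1)%VF a).
exists (L w); first exact: map_f.
have : algebra_image (L \o action N g \o L^-1)%VF.
  by apply/HH; exists (action N g) => //; exists g.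
case=> u uu /esym/(conj_lfunP _ _ bL) E; exists u => //.
by rewrite -amullE E -gw KL.
Qed.

Lemma unit_orbits_corresponding (N : prehomogeneous_module G) (A : falgType K) :
  equivalent_images (@module_image K m G N) (@algebra_image K A) ->
  finitely_many_unit_orbits A -> finitely_many_orbits N.
Proof.
case=> L bL HH [o Ho]; have [LK KL] := bij_lfunK bL.
exists (map (L^-1)%VF o) => v; have [w wo [u uu uw]] := Ho (L v).
exists ((L^-1)%VF w); first exact: map_f.
have [|h [g Gg ->] /(conj_lfunP _ _ bL) E] := (HH (amull u)).1.
  by exists u.
exists g => //; apply: (bij_inj bL).
by rewrite uw -E KL amullE.
Qed.

Section WithParametrization.
Variables (r s : nat) (phi : 'M[K]_m -> 'M[K]_(r + (1 + s))).
Variable psi : 'M[K]_(r + (1 + s)) -> 'M[K]_m.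
Hypothesis phi_morph : group_morphism G (@torus_vector_group K r s) phi.
Hypothesis psi_morph : group_morphism (@torus_vector_group K r s) G psi.
Hypothesis phiK : forall g, G g -> psi (phi g) = g.
Hypothesis psiK : forall h, @torus_vector_group K r s h -> phi (psi h) = h.

Let P := tv_param psi.

Lemma tv_param_inj v w : torus_nonzero v -> torus_nonzero w ->
  P v = P w -> v =1 w.
Proof.
move=> v0 w0 /(congr1 phi); rewrite !(phi_tv_param psiK) // => E i.
by rewrite -(tv_matrixK v) E tv_matrixK.
Qed.

Lemma eq_tv_param v w : v =1 w -> P v = P w.
Proof. by move=> vw; rewrite /P /tv_param (eq_tv_matrix vw). Qed.

(** * Comparison of the group with the unit group of the algebra *)

Section Rank.
Variables (A : falgType K) (mulC : commutative (@GRing.mul A)).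
Local Notation C := (comalg mulC).
Variables (rho : nat) (e : 'I_rho -> C) (x : C) (M : nat).
Hypothesis es : serial e x M.
Variable alpha : 'M[K]_m -> C.
Hypothesis alphaU : forall g, G g -> alpha g \is a GRing.unit.
Hypothesis alphaM : forall g h, G g -> G h -> alpha (g *m h) = alpha g * alpha
  h.
Hypothesis alpha_inj : forall g h, G g -> G h -> alpha g = alpha h -> g = h.
Hypothesis alphaR : vector_valued (regular_on G) (alpha : _ -> A).

Let alpha1 : alpha 1%:M = 1.
Proof.
have u := alphaU G1; have := alphaM G1 G1; rewrite mulmx1 => H.
by rewrite -[LHS](mulKr u) -H mulVr.
Qed.

Definition involution (b : {ffun 'I_r -> bool}) : 'I_(r + s) -> K :=
  fun i => if split i is inl k then (-1) ^+ b k else 0.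

Let inv0 b : torus_nonzero (involution b).
Proof. by move=> i; rewrite /involution (unsplitK (inl i)) signr_eq0. Qed.

Let invS b : P (involution b) *m P (involution b) = 1%:M.
Proof.
rewrite /P (tv_paramM psi_morph) //.
have [v v0 vE] := tv_param_surj phi_morph phiK G1; rewrite vE.
(* The parameter [v] of the identity is known only through this equation, which forces torus
   coordinates 1 and additive coordinates 0. *)
have vv : tv_mul v v =1 v.
  apply: tv_param_inj => //; last by rewrite /P -(tv_paramM psi_morph) // -vE
    mulmx1.
  by move=> i; rewrite /tv_mul (unsplitK (inl i)) mulf_neq0.
apply: eq_tv_param => i; have := vv i; have := v0.
rewrite /tv_mul /involution /torus_nonzero.
case: (split_ordP i) => k -> v0'; rewrite ?(unsplitK (inl k)) ?(unsplitK (inr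
  k)).
  move=> /eqP; rewrite -{3}[v _]mulr1 (inj_eq (mulfI (v0' k))) => /eqP ->.
  by rewrite -signr_addb addbb.
by move=> /eqP; rewrite addr0 -subr_eq0 addrK => /eqP ->.
Qed.

Let two_neq0 : (2%:R : K) != 0.
Proof. by rewrite ((pcharf0P K).1 charK0). Qed.

(** The residues of an involution are signs, and they determine it: for equal residues u u' = 1 + xc
    squares to 1, so xc(2 + xc) = 0, and 2 + xc is a unit. Hence 2^r <= 2^rho. *)
Lemma rank_leq : (r <= rho)%N.
Proof.
pose u b : C := alpha (P (involution b)).
have Ginv b : G (P (involution b)) := tv_param_in psi_morph (inv0 b).
have uu b : u b * u b = 1 by rewrite /u -alphaM // invS alpha1.
have chi2 b i : chi es (u b) i * chi es (u b) i = 1.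
  by rewrite -chiM uu chi1.
have chiS b i : (chi es (u b) i == 1) || (chi es (u b) i == -1).
  by rewrite -eqf_sqr expr1n expr2 chi2.
pose F (b : {ffun 'I_r -> bool}) : {ffun 'I_rho -> bool} :=
  [ffun i => chi es (u b) i == -1].
have chiV b i : chi es (u b) i = if F b i then -1 else 1.
  rewrite ffunE; have := chiS b i.
  by case: (eqVneq (chi es (u b) i) (-1)) => [->|_] //; rewrite orbF => /eqP.
have injF : injective F.
  move=> b b' FF.
  have cE i : chi es (u b) i = chi es (u b') i. by rewrite !chiV FF.
  have [c cE'] : exists c, u b * u b' - 1 = x * c.
    apply: (chi_eq0 (es := es)) => i; rewrite chiD chiM cE chi2.
    by rewrite -scaleN1r -[_ *: 1]/((-1)%:A) chi_alg subrr.
  have : (x * c) * (2%:R + x * c) = 0.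
    rewrite -cE'; transitivity ((u b * u b) * (u b' * u b') - 1); first by ring.
    by rewrite !uu mulr1 subrr.
  have -> : 2%:R + x * c = 2%:R *: (1 + x * (2%:R^-1 *: c)).
    by rewrite scalerDr scalerAr scalerA mulfV // scale1r scaler_nat.
  rewrite -scalerAr => /eqP; rewrite scaler_eq0 (negPf two_neq0) /= => /eqP H.
  have xc : x * c = 0.
    by have := congr1 (fun a => a / (1 + x * (2%:R^-1 *: c))) H;
      rewrite mul0r mulrK // (unit_1mulx es).
  have ub : u b = u b'.
    move/eqP: cE'; rewrite xc subr_eq0 => /eqP bb'.
    by rewrite -[LHS]mulr1 -(uu b') mulrA bb' mul1r.
  have := alpha_inj (Ginv b) (Ginv b') ub.
  move=> /(tv_param_inj (inv0 b) (inv0 b')) E; apply/ffunP => i.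
  have := E (lshift s i); rewrite /involution (unsplitK (inl i)).
  case: (b i); case: (b' i) => //= /eqP; rewrite ?expr0 ?expr1.
  - by rewrite eq_sym -addr_eq0 (negPf two_neq0).
  - by rewrite -addr_eq0 (negPf two_neq0).
have := leq_card _ injF; rewrite !card_ffun !card_ord !card_bool.
by rewrite leq_exp2l.
Qed.

Definition unipotent (a : 'rV[K]_s) : 'I_(r + s) -> K :=
  fun i => if split i is inr j then a 0 j else 1.

Let uni0 a : torus_nonzero (unipotent a).
Proof. by move=> i; rewrite /unipotent (unsplitK (inl i)) oner_neq0. Qed.

Let beta (a : 'rV[K]_s) : C := alpha (P (unipotent a)).

Let Guni a : G (P (unipotent a)) := tv_param_in psi_morph (uni0 a).

Let betaD a b : beta (a + b) = beta a * beta b.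
Proof.
rewrite /beta -alphaM // /P (tv_paramM psi_morph) //; congr alpha.
apply: eq_tv_param => i; rewrite /tv_mul /unipotent.
by case: (split i) => j; rewrite ?mulr1 ?mxE.
Qed.

Let beta0 : beta 0 = 1.
Proof.
have u : beta 0 \is a GRing.unit by apply: alphaU.
have := betaD 0 0; rewrite addr0 => H.
by rewrite -[LHS](mulKr u) -H mulVr.
Qed.

(* On a line in the unipotent part a regular function is a fraction whose
   denominator is a nowhere vanishing polynomial, hence constant. *)
Let beta_univariate a : vector_valued (@univariate K) (fun t =>
  beta (t *: a) : A).
Proof.
move=> l; have [p [q H]] := regular_tv_param G_alg psi_morph (alphaR l).
have line (p0 : {mpoly K[r + s]}) : univariate (fun t =>
  p0.@[unipotent (t *: a)]).
  apply: (@function_ring_meval K K _ (univariate_ring K) _ p0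
    (fun i t => unipotent (t *: a) i)) => i.
  rewrite /unipotent; case: (split i) => j; first by exists 1 => t;
    rewrite hornerC.
  by exists (a 0 j *: 'X) => t; rewrite mxE !hornerE mulrC.
have [p' pE] := line p; have [q' qE] := line q.
have [|c qc] := @univariate_neq0 K q'.
  by move=> t; rewrite -qE; have [] := H _ (uni0 (t *: a)).
exists (c^-1 *: p') => t; have [_ ->] := H _ (uni0 (t *: a)).
by rewrite pE qE qc hornerC hornerZ mulrC.
Qed.

Let chi_beta a i : chi es (beta a) i = 1.
Proof.
have [l lE] : exists l : 'Hom(A, K^o), forall v, l v = chi es v i.
  by apply: linear_lfun => k u v; rewrite (chi_linear es).
have [p pE] := beta_univariate a l.
(* Along the line through 0 and [a] the residue is a polynomial without zeros, hence equal to its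
   value 1 at the origin. *)
have [|c pc] := @univariate_neq0 K p.
  move=> t; rewrite -pE lE; have /(chi_unitP es) := alphaU (Guni (t *: a)).
  exact.
have E t : chi es (beta (t *: a)) i = c by rewrite -lE pE pc hornerC.
by rewrite -[a]scale1r E -(E 0) scale0r beta0 chi1.
Qed.

Let log_exists a : exists c, nilexp M (x * c) = beta a.
Proof.
have [b bE] : exists b, beta a - 1 = x * b.
  apply: (chi_eq0 (es := es)) => i; rewrite chiD chi_beta.
  by rewrite -scaleN1r -[_ *: 1]/((-1)%:A) chi_alg subrr.
have [c cE] := nilexp_surj es charK0 b; exists c.
by rewrite cE -bE addrC subrK.
Qed.

Let log a : C := x * sval (constructive_indefinite_description _ (log_exists
  a)).

Let logE a : nilexp M (log a) = beta a.
Proof. by rewrite /log; case: constructive_indefinite_description. Qed.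

Let logD a b : log (a + b) = log a + log b.
Proof.
apply: esym; rewrite {1 2}/log -mulrDr; apply: (nilexp_inj es charK0).
by rewrite mulrDr (nilexpD es charK0) -[x * sval _]/(log a) -[x * sval _]/(log
  b)
  !logE -betaD -logE.
Qed.

Let logMn a k : log (k%:R *: a) = k%:R *: log a.
Proof.
have log0 : log 0 = 0.
  by have := logD 0 0; rewrite addr0 -[X in X = _]addr0 => /addrI <-.
elim: k => [|k IH]; first by rewrite !scale0r log0.
by rewrite -natr1 !scalerDl !scale1r logD IH.
Qed.

(** Additivity yields only natural multiples. Both sides of exp(u log a) = beta(u a) are polynomial
    in [u], so agreement at the naturals extends to all of K. *)
Let logZ t a : log (t *: a) = t *: log a.
Proof.
have H u : nilexp M (u *: log a) = beta (u *: a).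
  rewrite (coords_expand (nilexp M (u *: log a) : A)).
  rewrite [RHS](coords_expand (beta (u *: a) : A)).
  apply: eq_bigr => i _; congr (_ *: _).
  have [p pE] : univariate (fun u => coords (nilexp M (u *: log a) : A) i).
    apply: (vector_valued_coord (univariate_ring K)).
    apply: (vector_valued_nilexp (univariate_ring K)).
    apply: (vector_valued_scale (univariate_ring K) (f := id)).
      by exists 'X => u'; rewrite hornerX.
    exact: vector_valued_cst (univariate_ring K) _ _.
  have [q qE] := vector_valued_coord (univariate_ring K) i (beta_univariate a).
  rewrite pE qE; congr horner; apply: (poly_nat_eq charK0) => n.
  by rewrite -pE -qE -logMn logE.
have := H t; rewrite -logE /log scalerAr => /(nilexp_inj es charK0) E.
by rewrite E.
Qed.

Lemma unipotent_rank_leq : (s <= \dim (limg (amull (x : A))))%N.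
Proof.
have [|l lE] := @linear_lfun K 'rV[K]_s A log.
  by move=> k u v; rewrite logD logZ.
have kl : lker l == 0%VS.
  apply/lker0P => a b; rewrite !lE => E; apply/rowP => j.
  have ab : beta a = beta b by rewrite -!logE -[log a]/(_ : A) E.
  have := alpha_inj (Guni a) (Guni b) ab.
  move=> /(tv_param_inj (uni0 a) (uni0 b)) /(_ (rshift r j)).
  by rewrite /unipotent (unsplitK (inr j)).
have <- : \dim {: 'rV[K]_s} = s by rewrite dimvf /dim /= mul1n.
rewrite -(@limg_dim_eq _ _ _ l) ?(eqP kl) ?capv0 //; apply: dimvS.
apply/subvP => _ /memv_imgP [a _ ->]; rewrite lE /log.
by apply/memv_imgP; exists (sval (constructive_indefinite_description _
  (log_exists a)) : A);
  rewrite ?memvf // amullE.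
Qed.

End Rank.

End WithParametrization.
End Prehomogeneous.

(** * Modules from algebras *)

Section SerialModule.
Variables (K : closedFieldType) (charK0 : [pchar K]%R =i pred0).
Variables (m : nat) (G : 'M[K]_m -> Prop) (G_alg : linear_algebraic_group G).
Variables (r s : nat) (phi : 'M[K]_m -> 'M[K]_(r + (1 + s))).
Variable psi : 'M[K]_(r + (1 + s)) -> 'M[K]_m.
Hypothesis phi_morph : group_morphism G (@torus_vector_group K r s) phi.
Hypothesis psi_morph : group_morphism (@torus_vector_group K r s) G psi.
Hypothesis phiK : forall g, G g -> psi (phi g) = g.
Hypothesis psiK : forall h, @torus_vector_group K r s h -> phi (psi h) = h.
Variables (A : falgType K) (mulC : commutative (@GRing.mul A)).
Local Notation C := (comalg mulC).
Variables (e : 'I_r -> C) (x : C) (M : nat).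
Hypothesis es : serial e x M.
Hypothesis dimA : \dim {:A} = (r + s)%N.

Let N := limg (amull (x : A)).
Let dimN : \dim N = s.
Proof. by apply: (@addnI r); rewrite -(dim_serial es). Qed.

Let nu (j : 'I_s) : C := (vbasis N)`_j.

Definition nil_part (v : 'I_(r + s) -> K) : C := \sum_j v (rshift r j) *: nu j.

Definition torus_part (v : 'I_(r + s) -> K) : C := \sum_i v (lshift s i) *: e i.

(** The isomorphism of (G_m)^r x (G_a)^s onto the unit group of A, restricted to nonzero torus
    coordinates; it is polynomial in the parameters. *)
Definition unit_of (v : 'I_(r + s) -> K) :
  C := torus_part v * nilexp M (nil_part v).

Lemma nil_partP v : exists a, nil_part v = x * a.
Proof.
have : (nil_part v : A) \in N.
  apply: memv_suml => j _; apply/memvZ/vbasis_mem/mem_nth.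
  by rewrite size_tuple dimN.
by case/memv_imgP => a _ ->; exists a; rewrite amullE.
Qed.

(** Only the additive coordinates are prescribed, so that [unit_of_surj] can still choose the torus
    coordinates of [v]. *)
Lemma nil_part_surj a : exists c : 'I_s -> K,
  forall v, (forall j, v (rshift r j) = c j) -> nil_part v = x * a.
Proof.
have aN : (x * a : A) \in N by apply/memv_imgP; exists (a : A);
  rewrite ?memvf ?amullE.
exists (fun j => coord (vbasis N) (cast_ord (esym dimN) j) (x * a : A)) => v vE.
rewrite -[RHS]/((x * a : A) : C) [in RHS](coord_vbasis aN) /nil_part.
rewrite (reindex (cast_ord dimN)) /=; last first.
  by exists (cast_ord (esym dimN)) => j _; rewrite ?cast_ordK ?cast_ordKV.
by apply: eq_bigr => j _; rewrite vE cast_ordK.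
Qed.

Lemma nil_part_inj v w : nil_part v = nil_part w ->
  forall j, v (rshift r j) = w (rshift r j).
Proof.
move=> vw; have fr := basis_free (vbasisP N).
have H u j : coord (vbasis N) (cast_ord (esym dimN) j) (nil_part u :
  A) = u (rshift r j).
  rewrite /nil_part (reindex (cast_ord dimN)) /=; last first.
    by exists (cast_ord (esym dimN)) => i _; rewrite ?cast_ordK ?cast_ordKV.
  by rewrite (coord_sum_free (fun i => u (rshift r (cast_ord dimN i)))) //
    cast_ordKV.
by move=> j; rewrite -H vw H.
Qed.

Lemma chi_unit_of v i : chi es (unit_of v) i = v (lshift s i).
Proof.
have [a aE] := nil_partP v.
by rewrite /unit_of chiM aE (chi_nilexp es) mulr1 chi_sum.
Qed.

Lemma unit_of_unit v : torus_nonzero v -> unit_of v \is a GRing.unit.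
Proof. by move=> v0; apply/(chi_unitP es) => i; rewrite chi_unit_of. Qed.

Lemma eq_unit_of v w : v =1 w -> unit_of v = unit_of w.
Proof.
move=> vw; rewrite /unit_of /torus_part /nil_part.
by congr (_ * nilexp M _); apply: eq_bigr => i _; rewrite vw.
Qed.

Lemma unit_ofM v w : unit_of (tv_mul v w) = unit_of v * unit_of w.
Proof.
have [a aE] := nil_partP v; have [b bE] := nil_partP w.
have tM : torus_part (tv_mul v w) = torus_part v * torus_part w.
  rewrite {2}/torus_part mulr_sumr; apply: eq_bigr => i _.
  by rewrite -scalerAr (sum_scale_e es) scalerA /tv_mul (unsplitK (inl i))
    mulrC.
have nD : nil_part (tv_mul v w) = nil_part v + nil_part w.
  rewrite -big_split; apply: eq_bigr => j _ /=.
  by rewrite /tv_mul (unsplitK (inr j)) scalerDl.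
by rewrite /unit_of tM nD aE bE (nilexpD es charK0); ring.
Qed.

Lemma unit_of_inj v w : torus_nonzero v ->
  unit_of v = unit_of w -> v =1 w.
Proof.
move=> v0 vw i.
have tE k : v (lshift s k) = w (lshift s k) by rewrite -!chi_unit_of vw.
have t_eq : torus_part v = torus_part w.
  by apply: eq_bigr => k _; rewrite tE.
case: (split_ordP i) => j -> //.
apply: nil_part_inj; have [a aE] := nil_partP v; have [b bE] := nil_partP w.
rewrite aE bE; apply: (nilexp_inj es charK0); rewrite -aE -bE.
have u : torus_part v \is a GRing.unit.
  by apply/(chi_unitP es) => k; rewrite chi_sum.
by rewrite -[LHS](mulKr u) -[_ * nilexp _ _]/(unit_of v) vw /unit_of -t_eq
  mulKr.
Qed.

Lemma unit_of_surj a : a \is a GRing.unit ->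
  exists2 v, torus_nonzero v & a = unit_of v.
Proof.
move=> ua; have a0 := elimT (chi_unitP es _) ua.
(* Dividing [a] by its semisimple part leaves residues 1, hence an exponential. *)
pose t : C := \sum_i chi es a i *: e i.
have ut : t \is a GRing.unit by apply/(chi_unitP es) => k; rewrite chi_sum.
have [b bE] : exists b, t^-1 * a - 1 = x * b.
  apply: (chi_eq0 (es := es)) => i; rewrite chiD.
  rewrite -scaleN1r -[_ *: 1]/((-1)%:A) chi_alg.
  have := chiM es t (t^-1 * a) i; rewrite mulVKr // chi_sum -{1}[chi es a
    i]mulr1.
  by move/(mulfI (a0 i)) => <-; rewrite subrr.
have [c cE] := nilexp_surj es charK0 b.
have [k kE] := nil_part_surj c.
pose v i := match split i with inl i => chi es a i | inr j => k j end.
exists v; first by move=> i; rewrite /v (unsplitK (inl i)).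
rewrite /unit_of kE => [|j]; last by rewrite /v (unsplitK (inr j)).
rewrite cE -bE addrC subrK; have -> : torus_part v = t.
  by apply: eq_bigr => i _; rewrite /v (unsplitK (inl i)).
by rewrite mulVKr.
Qed.

Definition group_unit (g : 'M[K]_m) : C := unit_of (tv_coord (phi g)).

Let phi_tv g : G g -> exists2 v, torus_nonzero v & phi g = tv_matrix v.
Proof. by move=> Gg; apply/torus_vector_groupP; case: phi_morph => + _ _;
  apply. Qed.

Lemma group_unitM g h : G g -> G h -> group_unit (g *m h) = group_unit g *
  group_unit h.
Proof.
move=> Gg Gh; case: phi_morph => _ phiM _; rewrite /group_unit phiM //.
have [v v0 ->] := phi_tv Gg; have [w w0 ->] := phi_tv Gh.
rewrite tv_matrixM !(eq_unit_of (tv_matrixK _)).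
by rewrite unit_ofM.
Qed.

Lemma group_unit_unit g : G g -> group_unit g \is a GRing.unit.
Proof.
by move=> Gg; have [v v0 vE] := phi_tv Gg;
  rewrite /group_unit vE (eq_unit_of (tv_matrixK _)) unit_of_unit.
Qed.

Lemma group_unit1 : group_unit 1%:M = 1.
Proof.
have G1 := lag_one G_alg; have u := group_unit_unit G1.
have := group_unitM G1 G1; rewrite mulmx1 => H.
by rewrite -[LHS](mulKr u) -H mulVr.
Qed.

Lemma group_unit_inj g h : G g -> G h -> group_unit g = group_unit h -> g = h.
Proof.
move=> Gg Gh; have [v v0 vE] := phi_tv Gg; have [w w0 wE] := phi_tv Gh.
rewrite -{2}(phiK Gg) -{2}(phiK Gh) /group_unit vE wE.
rewrite !(eq_unit_of (tv_matrixK _)) => /(unit_of_inj v0) vw.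
by rewrite (eq_tv_matrix vw).
Qed.

Lemma group_unit_surj a : a \is a GRing.unit -> exists2 g,
  G g & a = group_unit g.
Proof.
case/unit_of_surj => v v0 ->; exists (tv_param psi v).
  exact (tv_param_in psi_morph v0).
by rewrite /group_unit (phi_tv_param psiK) // (eq_unit_of (tv_matrixK _)).
Qed.

Lemma group_unit_regular : vector_valued (regular_on G) (group_unit : _ -> A).
Proof.
have RR := regular_on_ring (lag_unit G_alg).
have cR i : regular_on G (fun g => tv_coord (phi g) i).
  case: phi_morph => _ _ reg; rewrite /tv_coord.
  by case: (split i) => k; apply: reg.
apply: (vector_valued_mul RR (F := fun g => torus_part (tv_coord (phi g)) : A)
  (F' := fun g => nilexp M (nil_part (tv_coord (phi g))) : A)).
  apply: (@vector_valued_sum _ _ _ RR A _ _ _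
    (fun i g => tv_coord (phi g) (lshift s i) *: (e i : A))) => i.
  by apply: (vector_valued_scale RR); [apply: cR|apply: vector_valued_cst].
apply: (vector_valued_nilexp RR).
apply: (@vector_valued_sum _ _ _ RR A _ _ _
  (fun j g => tv_coord (phi g) (rshift r j) *: (nu j : A))) => j.
by apply: (vector_valued_scale RR); [apply: cR|apply: vector_valued_cst].
Qed.

Definition unit_action (g : 'M[K]_m) : 'End(A) := amull (group_unit g : A).

Lemma unit_action_one : unit_action 1%:M = \1%VF.
Proof. by rewrite /unit_action group_unit1 amull1. Qed.

Lemma unit_action_mul g h : G g -> G h ->
  unit_action (g *m h) = (unit_action g \o unit_action h)%VF.
Proof.
move=> Gg Gh; apply/lfunP => a; rewrite comp_lfunE /unit_action !amullE.
by rewrite group_unitM //; apply: esym; apply: (mulrA (group_unit g)).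
Qed.

Lemma unit_action_regular (l : 'Hom(A, K^o)) (v : A) :
  regular_on G (fun g => l (unit_action g v)).
Proof.
have RR := regular_on_ring (lag_unit G_alg).
apply: (@vector_valued_ext _ _ _ RR A (fun g => (group_unit g : A) * v)).
  by move=> g; rewrite /unit_action amullE.
apply: (vector_valued_mul RR (F' := fun=> v)); first exact: group_unit_regular.
exact: vector_valued_cst.
Qed.

Lemma unit_action_effective g : G g -> unit_action g = \1%VF -> g = 1%:M.
Proof.
move=> Gg /lfunP /(_ 1); rewrite id_lfunE /unit_action amullE mulr1 => g1.
by apply: group_unit_inj => //; [apply: lag_one|rewrite group_unit1].
Qed.

Lemma unit_action_open_orbit : exists v : A,
  zariski_open (fun w => exists2 g, G g & w = unit_action g v).
Proof.
exists 1.
(* The orbit of 1 is the unit group, the complement of the zero set of the product of the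
   residues. *)
have [p pE] : polynomial_function (fun a : A => \prod_i chi es (a : C) i).
  apply: (function_ring_prod (polynomial_function_ring A)) => i.
  by apply: linear_polynomial => k u v; rewrite chi_linear.
exists (fun q => q = p) => a; split=> [na q ->|a0].
  rewrite -pE; apply/eqP/negP => /negP a0; apply: na.
  have [|g Gg aE] := @group_unit_surj a.
    by apply/(chi_unitP es) => i; apply: contraNneq a0 => ai;
      rewrite (bigD1 i) //= ai mul0r.
  by exists g; rewrite // /unit_action amullE mulr1.
case=> g Gg aE; have := a0 p erefl; rewrite -pE => /eqP/prodf_eq0 [i _].
apply/negP; move: i; apply/(chi_unitP es); rewrite aE /unit_action amullE mulr1.
exact: group_unit_unit.
Qed.

Definition serial_module : prehomogeneous_module G :=
  PrehomogeneousModule unit_action_one unit_action_mul unit_action_regular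
    unit_action_effective unit_action_open_orbit.

Lemma serial_module_corresponding :
  equivalent_images (@module_image K m G serial_module) (@algebra_image K A).
Proof.
have b1 : bijective (\1%VF : 'End(A)) by exists id => v; rewrite lfunE.
exists (\1%VF : 'Hom(A, A)) => // h'; split.
  case=> a /group_unit_surj [g Gg ->] ->; exists (unit_action g);
    first by exists g.
  by apply/conj_lfunP => // v; rewrite !lfunE.
case=> _ [g Gg ->] /(conj_lfunP _ _ b1) E.
exists (group_unit g : A); first exact: group_unit_unit.
by apply/lfunP => a; have := E a; rewrite !id_lfunE.
Qed.

Lemma serial_module_orbits : finitely_many_orbits serial_module.
Proof.
apply: unit_orbits_corresponding serial_module_corresponding _.
exact: finitely_many_unit_orbits_of_serial es.
Qed.

End SerialModule.

(** * Algebras from modules *)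

Lemma zariski_open_preim (K : fieldType) (V W : vectType K) (f : V -> W)
    (O : W -> Prop) : linear f -> zariski_open O -> zariski_open (fun v =>
      O (f v)).
Proof.
move=> fL [I HI].
have pull (p : {mpoly K[\dim {:W}]}) : exists q : {mpoly K[\dim {:V}]},
    forall v, p.@[coords (f v)] = q.@[coords v].
  apply: (@function_ring_meval K V _ (polynomial_function_ring V) _ p
    (fun i v => coords (f v) i)) => i.
  by apply: linear_polynomial => k u v; rewrite fL /coords linearP.
exists (fun q => exists2 p, I p & forall v,
  p.@[coords (f v)] = q.@[coords v]) => v.
rewrite (HI (f v)); split=> [H q [p Ip <-]|H p Ip]; first exact: H.
by have [q qE] := pull p; rewrite qE; apply: H; exists p.
Qed.

(** The multiplication on V is built inside a proof, while algebra structures are declared globally;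
    this record carries the one to the other. *)
Record commutative_law (K : fieldType) (V : vectType K) := CommutativeLaw {
  law_mul : V -> V -> V;
  law_one : V;
  law_mulA : associative law_mul;
  law_mulC : commutative law_mul;
  law_mul1 : left_id law_one law_mul;
  law_mulDl : left_distributive law_mul +%R;
  law_one_neq0 : law_one != 0;
  law_scaleAl : forall k u v, k *: law_mul u v = law_mul (k *: u) v;
  law_scaleAr : forall k u v, k *: law_mul u v = law_mul u (k *: v)
}.

Definition law_algebra (K : fieldType) (V : vectType K)
  (L : commutative_law V) : Type := V.

HB.instance Definition _ K V (L : @commutative_law K V) :=
  Vector.copy (law_algebra L) V.
HB.instance Definition _ K V (L : @commutative_law K V) :=
  GRing.Zmodule_isComNzRing.Build (law_algebra L) (law_mulA L) (law_mulC L)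
    (law_mul1 L) (law_mulDl L) (law_one_neq0 L).
HB.instance Definition _ K V (L : @commutative_law K V) :=
  GRing.Lmodule_isLalgebra.Build K (law_algebra L) (law_scaleAl L).
HB.instance Definition _ K V (L : @commutative_law K V) :=
  GRing.Lalgebra_isAlgebra.Build K (law_algebra L) (law_scaleAr L).
HB.instance Definition _ K V (L : @commutative_law K V) :=
  Algebra_isFalgebra.Build K (law_algebra L).

Section CorrespondingAlgebra.
Variables (K : closedFieldType) (charK0 : [pchar K]%R =i pred0).
Variables (m : nat) (G : 'M[K]_m -> Prop) (G_alg : linear_algebraic_group G).
Hypothesis G_comm : commutative_group G.
Hypothesis G_nontrivial : exists2 g, G g & g <> 1%:M.
Variable N : prehomogeneous_module G.
Local Notation V := (Defs.space N).

Let G1 : G 1%:M := lag_one G_alg.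
Let GV := lag_inv G_alg.

Let act_comm g h v : G g -> G h ->
  action N g (action N h v) = action N h (action N g v).
Proof. by move=> Gg Gh; rewrite -!action_mulE // G_comm. Qed.

Variable v0 : V.
Hypothesis orbit_open : zariski_open (fun w =>
  exists2 g, G g & w = action N g v0).

(** The orbit is dense, and a proper subspace lies in the zero set of a nonzero coordinate of
    [v - projv W v]. *)
Lemma orbit_spanning (W : {vspace V}) : W != fullv ->
  exists2 g, G g & action N g v0 \notin W.
Proof.
move=> Wn; apply: NNPP => no.
have OW g : G g -> action N g v0 \in W.
  by move=> Gg; apply/negPn/negP => gW; apply: no; exists g.
have [w wW] : exists w, w \notin W.
  apply: NNPP => no'; case/eqP: Wn; apply/eqP; rewrite eqEsubv subvf /=.
  by apply/subvP => w _; apply/negPn/negP => wW; apply: no'; exists w.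
have [i wi] : exists i, coords (w - projv W w) i != 0.
  apply: NNPP => no'; case/negP: wW.
  have -> : w = projv W w; last exact: memv_proj.
  apply/eqP; rewrite -subr_eq0 [X in X == _]coords_expand big1 // => i _.
  by rewrite (_ : coords _ i = 0) ?scale0r //; apply/eqP/negPn/negP => wi;
    apply: no'; exists i.
have [p pE] : polynomial_function (fun v : V => coords (v - projv W v) i).
  apply: linear_polynomial => k u v; rewrite linearP /= opprD addrACA -scalerBr.
  by rewrite /coords linearP.
have p0 : p = 0.
  apply: (@open_dense K charK0 _ _ (action N 1%:M v0) p orbit_open);
    first by exists 1%:M.
  by move=> v [g Gg ->]; rewrite -pE projv_id ?OW // subrr /coords linear0.
by rewrite pE p0 meval0 eqxx in wi.
Qed.

Lemma orbit_basis : exists gs : (\dim {:V}).-tuple 'M[K]_m,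
  (forall g, g \in gs -> G g) /\
  basis_of {:V} (map (fun g => action N g v0) gs).
Proof.
have : forall k, (k <= \dim {:V})%N -> exists gs : k.-tuple 'M[K]_m,
    (forall g, g \in gs -> G g) /\ free (map (fun g => action N g v0) gs).
  elim=> [|k IH] kd; first by exists [tuple]; split => //; apply: nil_free.
  have [gs [Ggs fr]] := IH (ltnW kd).
  have [|g Gg gW] := @orbit_spanning <<map (fun g => action N g v0) gs>>%VS.
    apply: contraTneq kd => E; rewrite -leqNgt -E.
    by apply: leq_trans (dim_span _) _; rewrite size_map size_tuple.
  exists (cons_tuple g gs); split=> [h|]; last by rewrite /= free_cons gW.
  by rewrite inE => /predU1P [->|/Ggs].
case/(_ _ (leqnn _)) => gs [Ggs fr]; exists gs; split => //.
by rewrite basisEfree fr subvf size_map size_tuple leqnn.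
Qed.

Lemma corresponding_algebra_exists : exists A : falgType K,
  corresponding_algebra N A.
Proof.
have [gs [Ggs bas]] := orbit_basis.
pose b := map_tuple (fun g => action N g v0) gs.
have bE (i : 'I_(\dim {:V})) : b`_i = action N (tnth gs i) v0.
  by rewrite -tnth_nth tnth_map.
have Gi i : G (tnth gs i) by apply/Ggs/mem_tnth.
(* [mu v] is the element of the span of G that sends [v0] to [v]. It becomes multiplication by [v],
   with [v0] as the unit. *)
pose mu (v : V) : 'End(V) := \sum_i coord b i v *: action N (tnth gs i).
have muE v w : mu v w = \sum_i coord b i v *: action N (tnth gs i) w.
  by rewrite sum_lfunE; apply: eq_bigr => i _; rewrite scale_lfunE.
have mu0 v : mu v v0 = v.
  rewrite muE [RHS](coord_basis bas (memvf v)); apply: eq_bigr => i _.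
  by rewrite -bE.
have mu_act g v w : G g -> action N g (mu v w) = mu v (action N g w).
  move=> Gg; rewrite !muE linear_sum; apply: eq_bigr => i _.
  by rewrite linearZ /= act_comm.
have mu_comm u v w : mu u (mu v w) = mu v (mu u w).
  rewrite [mu v w]muE [mu v (mu u w)]muE linear_sum; apply: eq_bigr => i _.
  by rewrite linearZ /= mu_act.
(* Endomorphisms commuting with G are determined by their value at [v0], whose orbit contains a
   basis. Associativity and the formula for the action both follow from this. *)
have commE (T T' : 'End(V)) : (forall g w,
  G g -> action N g (T w) = T (action N g w)) ->
    (forall g w, G g -> action N g (T' w) = T' (action N g w)) ->
    T v0 = T' v0 -> T = T'.
  move=> cT cT' TT'; apply/lfunP => w; rewrite [w](coord_basis bas (memvf w)).
  rewrite !linear_sum; apply: eq_bigr => i _; rewrite !linearZ /=;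
    congr (_ *: _).
  by rewrite bE -cT // TT' cT'.
have muA u v w : mu u (mu v w) = mu (mu u v) w.
  have -> : mu (mu u v) = (mu u \o mu v)%VF; last by rewrite lfunE.
  apply: commE => [g z Gg|g z Gg|]; first exact: mu_act.
    by rewrite !lfunE /= !mu_act.
  by rewrite lfunE /= !mu0.
have muC u v : mu u v = mu v u.
  by rewrite -[in LHS](mu0 v) mu_comm mu0.
have mu1 v : mu v0 v = v by rewrite muC mu0.
have muL v : linear (mu v) by move=> k u w; rewrite linearP.
have muDl : left_distributive (fun u v => mu u v) +%R.
  by move=> u v w; rewrite !(muC _ w) linearD.
(* With [v0 = 0] the space would be zero and effectiveness would make G trivial; the algebra must
   have [1 != 0]. *)
have v0_neq0 : v0 != 0.
  apply/eqP => v00; case: G_nontrivial => g Gg; apply;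
    apply: (action_inj G_alg (N := N)) => //.
  apply/lfunP => w; have w0 : w = 0 by rewrite -(mu0 w) v00 linear0.
  by rewrite w0 !linear0.
have muZl (k : K) (u v : V) : k *: mu u v = mu (k *: u) v.
  by rewrite [RHS]muC linearZ /= muC.
have muZr (k : K) (u v : V) : k *: mu u v = mu u (k *: v).
  by rewrite linearZ.
pose law := CommutativeLaw muA muC mu1 muDl v0_neq0 muZl muZr.
exists (law_algebra law : falgType K); split; first exact: muC.
have b1 : bijective (\1%VF : 'Hom(V, law_algebra law)) by exists id => v;
  rewrite lfunE.
have actE g v : G g -> action N g v = (action N g v0 : law_algebra law) * v.
  move=> Gg; have E : action N g = mu (action N g v0).
    apply: commE => [h w Gh|h w Gh|]; [exact: act_comm|exact: mu_act|].
    by rewrite mu0.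
  by rewrite {1}E.
exists \1%VF => // h'; split; last first.
  case=> _ [g Gg ->] /(conj_lfunP _ _ b1) E;
    exists (action N g v0 : law_algebra law).
    apply/unitrP; exists (action N (invmx g) v0 : law_algebra law).
    split.
      have <- := actE (invmx g) (action N g v0) (GV Gg).
      by rewrite -(action_mulE v0 (GV Gg) Gg) mulVmx ?(lag_unit G_alg) //
        action_oneE.
    have <- := actE g (action N (invmx g) v0) Gg; exact: action_invK.
  apply/lfunP => v; have := E v; rewrite !id_lfunE => ->.
  by rewrite amullE; apply: actE.
case=> a ua ->.
have mulaL : linear (fun v : V => (a^-1 * (v : law_algebra law) :
  law_algebra law) : V).
  by move=> k u v; apply: muL.
have O1 : exists2 g, G g & action N 1%:M v0 = action N g v0 by exists 1%:M.
have aO : exists2 g, G g & (a^-1 * (a * (v0 : law_algebra law)) :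
  V) = action N g v0.
  by exists 1%:M => //; rewrite mulKr // action_oneE.
have [v [g Gg vg] [h Gh vh]] := open_inter charK0 orbit_open O1
  (zariski_open_preim mulaL orbit_open) aO.
(* A common point v = g v0 = a (h v0) of the two open sets shows that multiplication by [a] is the
   action of g h^(-1). *)
exists (action N (g *m invmx h)).
  by exists (g *m invmx h) => //; apply: (lag_mul G_alg) => //; apply: GV.
apply/conj_lfunP => // w; rewrite !id_lfunE amullE (action_mulE w Gg (GV Gh)).
rewrite (actE g _ Gg) -vg; have -> : v = (a * (action N h v0 :
  law_algebra law) : V).
  by rewrite -vh mulVKr.
rewrite -mulrA; have <- := actE h (action N (invmx h) w) Gh.
by rewrite (action_invK G_alg).
Qed.


End CorrespondingAlgebra.

(** * Classification *)

(* {poly %/ h} has no canonical falgType structure. *)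
Definition quotient_algebra (K : fieldType) (h : {poly K}) :
  Type := {poly %/ h}.

HB.instance Definition _ (K : fieldType) (h : {poly K}) :=
  GRing.ComUnitAlgebra.copy (quotient_algebra h) {poly %/ h}.
HB.instance Definition _ (K : fieldType) (h : {poly K}) :=
  Vector.copy (quotient_algebra h) {poly %/ h}.

Lemma quotient_algebra_monogenic (K : fieldType) (h : {poly K}) :
  h \is monic -> (1 < size h)%N -> monogenic (qpolyX h : quotient_algebra h) h.
Proof.
move=> mh sh.
have ev p : horner_alg (qpolyX h : quotient_algebra h) p = in_qpoly h p.
  elim/poly_ind: p => [|p c IH]; first by rewrite !rmorph0.
  rewrite !rmorphD !rmorphM /= IH horner_algX horner_algC.
  by congr (_ + _); rewrite -[c%:P]alg_polyC linearZ /= rmorph1.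
split=> [a|p]; first by exists (val a); rewrite ev in_qpolyK.
by rewrite ev; apply: in_qpoly_eq0.
Qed.

Lemma monogenic_mulC (K : fieldType) (A : algType K) (y : A) (h : {poly K}) :
  monogenic y h -> commutative (@GRing.mul A).
Proof.
case=> sur _ a b; have [p ->] := sur a; have [q ->] := sur b.
by rewrite -!rmorphM mulrC.
Qed.

Lemma monogenic_image_equivalent (K : fieldType) (A B : falgType K) (y : A)
    (z : B) (h : {poly K}) : (1 < size h)%N -> monogenic y h -> monogenic z h ->
  equivalent_images (@algebra_image K A) (@algebra_image K B).
Proof.
move=> sh mA mB.
have image (D : falgType K) (w : D) : monogenic w h ->
    equivalent_images (@algebra_image K D)
      (@algebra_image K (quotient_algebra ((lead_coef h)^-1 *: h))).
  move=> mD; have [|phi bphi] := (isomorphic_to_quotientP D sh).2;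
    first by exists w.
  exact: (@algebra_image_iso K D (quotient_algebra _) phi).
apply: equivalent_images_trans (image A y mA) _.
exact/equivalent_images_sym/(image B z mB).
Qed.

(** Take a nonzero scalar [c] different from all residues of [a], and write a = (a - c) + c. *)
Lemma serial_units_span (K : fieldType) (charK0 : [pchar K]%R =i pred0)
    (A : falgType K) (mulC : commutative (@GRing.mul A)) (rho : nat)
    (e : 'I_rho -> comalg mulC) x M : serial e x M ->
  forall a : A, exists u v, [/\ u \is a GRing.unit,
    v \is a GRing.unit & a = u + v].
Proof.
move=> es a; have [c] := exists_notin charK0 (0 :: codom (chi es (a :
  comalg mulC))).
rewrite inE negb_or => /andP [c0 cs].
exists (a - c%:A), (c%:A); split; last by rewrite subrK.
  change ((a : comalg mulC) - c%:A \is a GRing.unit); apply/(chi_unitP es) => i.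
  rewrite -scaleNr chiD chi_alg subr_eq0; apply: contraNneq cs => <-.
  exact: codom_f.
change ((c%:A : comalg mulC) \is a GRing.unit); apply/(chi_unitP es) => i.
by rewrite chi_alg.
Qed.

Section Classification.
Variables (K : closedFieldType) (charK0 : [pchar K]%R =i pred0).
Variables (m n r : nat) (G : 'M[K]_m -> Prop).
Hypothesis G_alg : linear_algebraic_group G.
Hypothesis G_comm : commutative_group G.
Hypothesis r_gt0 : (0 < r)%N.
Hypothesis G_dim : has_dimension G n.
Hypothesis G_rank : has_rank G r.

(** The parameters with all coordinates 1 and all coordinates -1 give two different elements, as r >
    0 and the characteristic is not 2. *)
Lemma group_nontrivial : exists2 g, G g & g <> 1%:M.
Proof.
case: G_rank => s [phi [psi [phi_morph psi_morph phiK psiK]]].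
have T0 (c : K) : c != 0 -> torus_nonzero (fun _ : 'I_(r + s) =>
  c) by move=> c0 i.
have N0 : (-1 : K) != 0 by rewrite oppr_eq0 oner_eq0.
pose v (c : K) : 'I_(r + s) -> K := fun=> c.
have Gv c : c != 0 -> G (tv_param psi (v c)).
  by move=> c0; apply: (tv_param_in psi_morph); apply: T0.
case: (classic (tv_param psi (v 1) = 1%:M)) => [E1|ne]; last first.
  by exists (tv_param psi (v 1)) => //; apply: Gv; rewrite oner_eq0.
exists (tv_param psi (v (-1))); first exact: Gv.
rewrite -E1 => /(tv_param_inj psiK (T0 _ N0) (T0 _ (oner_neq0 K))).
move=> /(_ (lshift s (Ordinal r_gt0))) /eqP; rewrite /v eq_sym -addr_eq0.
by rewrite -[1 + 1]/(2%:R) ((pcharf0P K).1 charK0).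
Qed.

Lemma finite_orbits_serial (N : prehomogeneous_module G) (A : falgType K)
    (mulC : commutative (@GRing.mul A)) :
  finitely_many_orbits N ->
  equivalent_images (@module_image K m G N) (@algebra_image K A) ->
  exists (e : 'I_r -> comalg mulC) x M, serial e x M /\ \dim {:A} = n.
Proof.
move=> fN NA; case: G_rank => s [phi [psi [phi_morph psi_morph phiK psiK]]].
have nE : n = (r + s)%N.
  apply/eqP; rewrite eqn_leq (has_dimension_leq G_alg phi_morph psi_morph phiK
    G_dim).
  exact: (has_dimension_geq charK0 phi_morph psi_morph psiK G_dim).
have [rho [e [x [M es]]]] := finitely_many_unit_orbits_serial charK0 mulC
  (corresponding_unit_orbits NA fN).
have [alpha [aU aM aI aR]] := corresponding_morphism G_alg NA.
have r_rho : (r <= rho)%N.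
  exact: (rank_leq charK0 G_alg phi_morph psi_morph phiK psiK es aU aM aI).
have s_dim := unipotent_rank_leq charK0 G_alg psi_morph psiK es aU aM aI aR.
have dimA : (\dim {:A} <= n)%N.
  case: NA => L bL _; rewrite -(dim_bij bL).
  exact: (dim_prehomogeneous charK0 G_alg).
move: dimA; rewrite (dim_serial es) nE => dimA.
have rE : rho = r.
  apply/eqP; rewrite eqn_leq r_rho andbT -(leq_add2r s).
  by apply: leq_trans dimA; rewrite leq_add2l.
move: e es s_dim dimA; rewrite rE => e es s_dim dimA.
exists e, x, M; split => //; apply/eqP.
by rewrite eqn_leq dimA leq_add2l.
Qed.

Lemma serial_finite_orbits (A : falgType K) (mulC : commutative (@GRing.mul A))
    (e : 'I_r -> comalg mulC) x M : serial e x M -> \dim {:A} = n ->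
  exists2 N : prehomogeneous_module G, finitely_many_orbits N &
    equivalent_images (@module_image K m G N) (@algebra_image K A).
Proof.
move=> es dimA; case: G_rank => s [phi [psi [phi_morph psi_morph phiK psiK]]].
have nE : n = (r + s)%N.
  apply/eqP; rewrite eqn_leq (has_dimension_leq G_alg phi_morph psi_morph phiK
    G_dim).
  exact: (has_dimension_geq charK0 phi_morph psi_morph psiK G_dim).
rewrite nE in dimA.
exists (serial_module charK0 G_alg phi_morph psi_morph phiK psiK es dimA).
  exact: serial_module_orbits.
exact: serial_module_corresponding.
Qed.

Lemma prodXsubCexp_size_gt1 (lam : 'I_r -> K) (mu : 'I_r -> nat) :
  (forall i, 0 < mu i)%N -> (1 < size (prodXsubCexp lam mu))%N.
Proof.
move=> mu0; rewrite size_prodXsubCexp ltnS (bigD1 (Ordinal r_gt0)) //=.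
by apply: leq_trans (leq_addr _ _); apply: mu0.
Qed.

Lemma monogenic_finite_orbits (A : falgType K) (y : A) (lam : 'I_r -> K)
    (mu : 'I_r -> nat) : injective lam -> (forall i, 0 < mu i)%N ->
  (\sum_i mu i = n)%N -> monogenic y (prodXsubCexp lam mu) ->
  exists2 N : prehomogeneous_module G, finitely_many_orbits N &
    equivalent_images (@module_image K m G N) (@algebra_image K A).
Proof.
move=> injl mu0 mun mono; have mulC := monogenic_mulC mono.
have [e [x [M es]]] := monogenic_serial mulC injl mu0 mono.
apply: serial_finite_orbits es _.
by rewrite (dim_monogenic (prodXsubCexp_size_gt1 _ mu0) mono) size_prodXsubCexp.
Qed.

Definition natr_ord (i : 'I_r) : K := (i : nat)%:R.

Lemma natr_ord_inj : injective natr_ord.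
Proof. by move=> i j /(natr_inj_pchar0 charK0) /val_inj. Qed.

(** The multiplicities are fixed before the roots, so [classification] may still permute the
    latter. *)
Lemma finite_orbits_monogenic (N : prehomogeneous_module G) (A : falgType K) :
  finitely_many_orbits N -> corresponding_algebra N A ->
  exists mu : 'I_r -> nat, [/\ forall i, (0 < mu i)%N, (\sum_i mu i = n)%N
    & forall lam, injective lam -> exists y : A,
      monogenic y (prodXsubCexp lam mu)].
Proof.
move=> fN [mulC NA].
have [e [x [M [es dimA]]]] := finite_orbits_serial mulC fN NA.
exists (local_length es); split; first exact: local_length_gt0.
  have mono := serial_monogenic es natr_ord_inj.
  have := dim_monogenic (prodXsubCexp_size_gt1 _ (local_length_gt0 es)) mono.
  by rewrite dimA size_prodXsubCexp /= => ->.
by move=> lam /(serial_monogenic es) mono; eexists; apply: mono.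
Qed.

Lemma corresponding_algebras (A : falgType K) :
  (exists2 N : prehomogeneous_module G,
     finitely_many_orbits N & corresponding_algebra N A) <->
  (exists f : {poly K},
     [/\ size f = n.+1, has_distinct_roots f r & isomorphic_to_quotient A f]).
Proof.
split=> [[N fN NA]|[f [szf rf isoA]]].
  have [mu [mu0 mun mono]] := finite_orbits_monogenic fN NA.
  exists (prodXsubCexp natr_ord mu); split.
  - by rewrite size_prodXsubCexp mun.
  - exact: distinct_roots_prodXsubCexp natr_ord_inj mu0.
  apply/isomorphic_to_quotientP; first exact: prodXsubCexp_size_gt1.
  exact: mono natr_ord_inj.
have f0 : f != 0 by rewrite -size_poly_gt0 szf.
have [lam [mu [injl mu0 fE]]] := distinct_rootsP f0 rf.
have szP : size f = size (prodXsubCexp lam mu).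
  by rewrite {1}fE size_scale // lead_coef_eq0.
have sz1 := prodXsubCexp_size_gt1 lam mu0.
have [|y [sur ker]] := (isomorphic_to_quotientP A _).1 isoA;
  first by rewrite szP.
have mono : monogenic y (prodXsubCexp lam mu).
  by split=> // p; rewrite ker {1}fE dvdpZl // lead_coef_eq0.
have mun : (\sum_i mu i = n)%N.
  by apply: succn_inj; rewrite -(size_prodXsubCexp lam) -szP szf.
have [N fN NA] := monogenic_finite_orbits injl mu0 mun mono.
by exists N => //; split => //; apply: monogenic_mulC mono.
Qed.

Definition is_partition (t : r.-tuple 'I_n.+1) : bool :=
  [&& sorted geq [seq val i | i <- t], all (fun i : 'I_n.+1 => 0 < i)%N t
    & \sum_(i <- t) i == n]%N.

Definition part (t : r.-tuple 'I_n.+1) (i : 'I_r) : nat := tnth t i.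

Lemma is_partitionP t : is_partition t ->
  (forall i, 0 < part t i)%N /\ (\sum_i part t i = n)%N.
Proof.
case/and3P => _ /allP pos /eqP sm; split=> [i|]; first by apply: pos;
  apply: mem_tnth.
by rewrite -[RHS]sm big_tuple.
Qed.

(** An injective matching of positions is a permutation, and sorted sequences that are permutations
    of each other are equal. *)
Lemma part_inj t t' : is_partition t -> is_partition t' ->
  (exists2 f : 'I_r -> 'I_r, injective f & forall i,
    part t i = part t' (f i)) ->
  t = t'.
Proof.
case/and3P => st _ _ /and3P [st' _ _] [f injf E].
apply: val_inj; apply: (inj_map val_inj).
have geq_trans : transitive geq by move=> a b c ba ac; apply: leq_trans ac ba.
have geq_anti : antisymmetric geq by move=> a b; rewrite andbC => /anti_leq.
apply: (sorted_eq geq_trans geq_anti st st').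
apply/(perm_map val)/tuple_permP; exists (perm injf); congr val.
by apply: eq_from_tnth => i; rewrite tnth_mktuple permE; apply: val_inj;
  apply: E.
Qed.

Lemma partition_exists (mu : 'I_r -> nat) :
  (forall i, 0 < mu i)%N -> (\sum_i mu i = n)%N ->
  exists2 t, is_partition t &
    exists2 f : 'I_r -> 'I_r, injective f & forall i, mu i = part t (f i).
Proof.
move=> mu0 mun; pose u := [tuple (inord (mu i) : 'I_n.+1) | i < r].
have uE i : tnth u i = mu i :> nat.
  rewrite tnth_mktuple inordK // ltnS -mun (bigD1 i) //=.
  exact: leq_addr.
pose le := relpre (val : 'I_n.+1 -> nat) geq.
pose t := [tuple of sort le u].
have tu : perm_eq t u by rewrite perm_sort.
exists t.
  apply/and3P; split.
  - by rewrite sorted_map; apply: sort_sorted => a b; apply: leq_total.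
  - rewrite (perm_all _ tu); apply/allP => a /tnthP [i ->].
    by rewrite uE.
  - rewrite (perm_big _ tu) big_tuple -[X in _ == X]mun;
    apply/eqP/eq_bigr => i _.
    exact: uE.
rewrite perm_sym in tu; have /tuple_permP [p pE] := tu.
exists p; first exact: perm_inj.
move=> i; rewrite -uE /part; congr (nat_of_ord _).
by rewrite (val_inj pE) tnth_mktuple.
Qed.

Lemma classification :
  exists M : 'I_(partitions_count r n) -> prehomogeneous_module G,
     [/\ forall i, finitely_many_orbits (M i),
         forall i j, equivalent_modules (M i) (M j) -> i = j
       & forall N : prehomogeneous_module G, finitely_many_orbits N ->
           exists i, equivalent_modules N (M i)].
Proof.
pose S := [set t : r.-tuple 'I_n.+1 | is_partition t].
rewrite -[partitions_count r n]/(#|S|).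
(* Model algebras: the roots are the fixed scalars 0, ..., r - 1, and the partition supplies the
   multiplicities. *)
pose f t := prodXsubCexp natr_ord (part t).
pose D t : falgType K := quotient_algebra (f t).
have monoD t : is_partition t -> monogenic (qpolyX (f t) : D t) (f t).
  move=> /is_partitionP [t0 _]; apply: quotient_algebra_monogenic.
    exact: prodXsubCexp_monic.
  exact: prodXsubCexp_size_gt1.
have St (i : 'I_#|S|) : is_partition (enum_val i).
  by have := enum_valP i; rewrite inE.
have H (i : 'I_#|S|) : exists N : prehomogeneous_module G,
    finitely_many_orbits N /\
    equivalent_images (@module_image K m G N) (@algebra_image K (D (enum_val
      i))).
  have [t0 tn] := is_partitionP (St i).
  have [N fN ND] := monogenic_finite_orbits natr_ord_inj t0 tn (monoD _ (St i)).
  by exists N.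
exists (fun i => sval (constructive_indefinite_description _ (H i))); split.
- by move=> i; case: constructive_indefinite_description => N [].
- move=> i j; case: constructive_indefinite_description => N [_ ND] /=.
  case: constructive_indefinite_description => N' [_ ND'] /= NN'.
  have DD : equivalent_images (@algebra_image K (D (enum_val i)))
      (@algebra_image K (D (enum_val j))).
    apply: equivalent_images_trans ND'; apply: equivalent_images_trans NN'.
    exact: equivalent_images_sym.
  have [ti0 tin] := is_partitionP (St i);
    have [tj0 tjn] := is_partitionP (St j).
  have mD := monoD _ (St i); have mulC := monogenic_mulC mD.
  have [e [x [M es]]] := monogenic_serial mulC natr_ord_inj ti0 mD.
  have [phi injphi] := algebra_image_lrmorphism (serial_units_span charK0 es)
    DD.
  apply/enum_val_inj/part_inj; [exact: St|exact: St|].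
  by apply: (monogenic_lrmorphism injphi natr_ord_inj ti0 _ mD (monoD _ (St
    j))); rewrite tin tjn.
move=> N fN.
have [v0 O_open] := action_open_orbit N.
have [A NA] := corresponding_algebra_exists charK0 G_alg G_comm
  group_nontrivial O_open.
have [mu [mu0 mun mono]] := finite_orbits_monogenic fN NA.
have [t tP [p injp pE]] := partition_exists mu0 mun.
have tS : t \in S by rewrite inE.
exists (enum_rank_in tS t).
case: constructive_indefinite_description => N' [_ N'D] /=.
rewrite enum_rankK_in // in N'D.
(* The roots are listed through [p] so that the exponent [mu i = part t (p i)] falls on the root it
   has in [f t]. *)
have [y] := mono (natr_ord \o p) (inj_comp natr_ord_inj injp).
have -> : prodXsubCexp (natr_ord \o p) mu = f t.
  rewrite /f /prodXsubCexp [RHS](reindex_inj injp); apply: eq_bigr => i _.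
  by rewrite pE.
move=> monoA; have [t0 _] := is_partitionP tP.
apply: equivalent_images_trans NA.2 _;
  apply: equivalent_images_trans (equivalent_images_sym N'D).
apply: monogenic_image_equivalent monoA (monoD _ tP).
exact: prodXsubCexp_size_gt1.
Qed.

End Classification.

Local Close Scope ring_scope.

Theorem corollary2 (K : closedFieldType) (charK0 : [pchar K]%R =i pred0)
    (m n r : nat) (G : 'M[K]_m -> Prop)
    (G_alg : linear_algebraic_group G)
    (G_conn : zariski_connected G)
    (G_comm : commutative_group G)
    (n_gt0 : 0 < n) (r_gt0 : 0 < r)
    (G_dim : has_dimension G n)
    (G_rank : has_rank G r) :
  (exists M : 'I_(partitions_count r n) -> prehomogeneous_module G,
     [/\ forall i, finitely_many_orbits (M i),
         forall i j, equivalent_modules (M i) (M j) -> i = j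
       & forall N : prehomogeneous_module G, finitely_many_orbits N ->
           exists i, equivalent_modules N (M i)]) /\
  (forall A : falgType K,
     (exists2 N : prehomogeneous_module G,
        finitely_many_orbits N & corresponding_algebra N A) <->
     (exists f : {poly K},
        [/\ size f = n.+1, has_distinct_roots f r
          & isomorphic_to_quotient A f])).
Proof.
split; first exact: classification.
exact: corresponding_algebras.
Qed.
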